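(* The decision problem \textsc{MaxQueryDec} is in $\mathsf{NP}$. Here \textsc{MaxQueryDec} is the following problem. Input: a positive integer $K$; an antimonotonic family $\mathcal{F} = \{B_1,\ldots,B_N\}$ of itemsets over the attributes $A=\{a_1,\ldots,a_K\}$, listed explicitly; a vector $\theta = (\theta_1,\ldots,\theta_N)$ of rational numbers that is consistent for $\mathcal{F}$; an itemset $B \subseteq A$; and a rational threshold $b$. Question: is there a probability distribution $q$ on $\Omega=\{0,1\}^K$ satisfying the frequencies $\theta$ (i.e. $q(B_i = 1) = \theta_i$ for all $i=1,\ldots,N$) such that $q(B=1) > b$?
   Context: Let $\Omega = \{0,1\}^K$ be the sample space of binary vectors of length $K$; the $i$-th coordinate is called attribute $a_i$, and $A=\{a_1,\ldots,a_K\}$. An itemset is a subset of $A$. A family of itemsets is antimonotonic if every subset of every member of the family also belongs to the family. For a probability distribution $p$ on $\Omega$, an itemset $B=\{a_{i_1},\ldots,a_{i_L}\}$ and $t \in \{0,1\}^L$, write $p(B=t)$ for $p(a_{i_1}=t_1,\ldots,a_{i_L}=t_L)$, and $p(B=1)$ for $p(B=t)$ with $t$ the all-ones vector; $p(B=1)$ is the frequency of $B$ under $p$. Given a family $\{B_1,\ldots,B_N\}$ and a vector $\theta$ of length $N$, a distribution $p$ satisfies the frequencies if $p(B_i=1)=\theta_i$ for all $i$; the frequencies are consistent if some distribution on $\Omega$ satisfies them. *)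

(* Defs.v *)
From HB Require Import structures.
From mathcomp Require Import all_boot all_order all_algebra.
From mathcomp Require Import reals.

Set Implicit Arguments.
Unset Strict Implicit.
Unset Printing Implicit Defensive.

Import Order.TTheory GRing.Theory Num.Theory.
Local Open Scope ring_scope.

(** * Deterministic multi-tape Turing machines *)

Inductive move := MoveL | Stay | MoveR.

(** The tape alphabet contains the input alphabet [S] and a further finite
    alphabet [W] of work symbols; [None] is the blank. *)
Definition tsym (S W : finType) : Type := option (S + W).

(** [tm_halt s] is [None] when [s] is not a halting state, [Some true] when it
    accepts and [Some false] when it rejects. *)
Record tm (S : finType) := Tm {
  tm_work : finType;
  tm_extra : nat;
  tm_state : finType;
  tm_start : tm_state;
  tm_halt : tm_state -> option bool;
  tm_trans : tm_state -> {ffun 'I_tm_extra.+1 -> tsym S tm_work} ->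
             tm_state * {ffun 'I_tm_extra.+1 -> tsym S tm_work * move}
}.

(** A two-way infinite tape: [tleft] lists the cells to the left of the head,
    nearest first, and [tright] the cell under the head followed by those to
    its right; all cells not listed are blank. *)
Record tape (X : Type) := Tape {
  tleft : seq (option X);
  tright : seq (option X)
}.

Definition tread X (t : tape X) : option X := head None (tright t).

Definition twrite X (a : option X) (t : tape X) : tape X :=
  Tape (tleft t) (a :: behead (tright t)).

Definition tmove X (d : move) (t : tape X) : tape X :=
  match d with
  | MoveL => Tape (behead (tleft t)) (head None (tleft t) :: tright t)
  | Stay => t
  | MoveR => Tape (tread t :: tleft t) (behead (tright t))
  end.

Section Run.
Variables (S : finType) (M : tm S).

Definition config : Type :=
  tm_state M * ('I_(tm_extra M).+1 -> tape (S + tm_work M)).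

Definition init (x : seq S) : config :=
  (tm_start M,
   fun i => Tape [::] (if i == ord0 then [seq Some (inl a) | a <- x] else [::])).

Definition step (c : config) : config :=
  if tm_halt c.1 is Some _ then c else
  let r := tm_trans c.1 [ffun i => tread (c.2 i)] in
  (r.1, fun i => tmove (r.2 i).2 (twrite (r.2 i).1 (c.2 i))).

Definition outcome (x : seq S) (t : nat) : option bool :=
  tm_halt (iter t step (init x)).1.

End Run.

(** * The classes P and NP *)

Definition in_P (S : finType) (L : seq S -> Prop) : Prop :=
  exists (M : tm S) (p : {poly nat}), forall x : seq S,
    exists t : nat, (t <= p.[size x])%N /\
      exists b : bool, outcome M x t = Some b /\ (b <-> L x).

(** The pair of an input and a binary certificate, as one word. The two
    components are over disjoint alphabets, so no separator is needed. *)
Definition word_pair (S : finType) (x : seq S) (u : seq bool) :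
    seq (S + bool)%type :=
  [seq inl a | a <- x] ++ [seq inr c | c <- u].

Definition in_NP (S : finType) (L : seq S -> Prop) : Prop :=
  exists (V : seq (S + bool)%type -> Prop) (q : {poly nat}),
    in_P V /\
    forall x : seq S,
      L x <-> exists u : seq bool, (size u <= q.[size x])%N /\ V (word_pair x u).

(** * Itemsets and frequencies *)

Definition itemset (K : nat) : finType := {set 'I_K}.

Definition antimonotonic (K : nat) (F : {pred itemset K}) : Prop :=
  forall B C : itemset K, B \in F -> C \subset B -> C \in F.

Section Distributions.
Variables (R : realType) (K : nat).

Definition distribution (p : {ffun K.-tuple bool -> R}) : Prop :=
  (forall w, 0 <= p w) /\ \sum_w p w = 1.

(** The frequency p(B = 1). *)
Definition freq (p : {ffun K.-tuple bool -> R}) (B : itemset K) : R :=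
  \sum_(w : K.-tuple bool | [forall i in B, tnth w i]) p w.

Definition satisfies (N : nat) (Bs : N.-tuple (itemset K))
    (theta : N.-tuple rat) (p : {ffun K.-tuple bool -> R}) : Prop :=
  forall i : 'I_N, freq p (tnth Bs i) = ratr (tnth theta i).

Definition consistent (N : nat) (Bs : N.-tuple (itemset K))
    (theta : N.-tuple rat) : Prop :=
  exists p, distribution p /\ satisfies Bs theta p.

End Distributions.

(** * The decision problem *)

Record query := Query {
  q_K : nat;
  q_N : nat;
  q_fam : q_N.-tuple (itemset q_K);
  q_theta : q_N.-tuple rat;
  q_target : itemset q_K;
  q_bound : rat
}.

Definition admissible (R : realType) (I : query) : Prop :=
  [/\ (0 < q_K I)%N, uniq (q_fam I), antimonotonic [in q_fam I]
    & consistent R (q_fam I) (q_theta I)].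

Definition exceeds (R : realType) (I : query) : Prop :=
  exists q : {ffun (q_K I).-tuple bool -> R},
    [/\ distribution q, satisfies (q_fam I) (q_theta I) q
      & ratr (q_bound I) < freq q (q_target I)].

(** Words are over the bits [Some b] and the separator [None]. *)
Definition sym : finType := option bool.

(** Binary digits, least significant first, without leading zeros; 0 is the
    empty word. *)
Definition bits (n : nat) : seq bool :=
  mkseq (fun i => odd (n %/ 2 ^ i)) (up_log 2 n.+1).

Definition enc_rat (r : rat) : seq sym :=
  Some (r < 0) :: map Some (bits `|numq r|%N) ++
  None :: map Some (bits `|denq r|%N) ++ [:: None].

Definition enc_itemset (K : nat) (B : itemset K) : seq sym :=
  [seq Some (i \in B) | i <- enum 'I_K] ++ [:: None].

(** The number of attributes is the length of the indicator vector of the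
    target itemset (that is, it is written in unary), and the size of the
    family is the number of entries that follow the threshold. *)
Definition encode (I : query) : seq sym :=
  enc_itemset (q_target I) ++ enc_rat (q_bound I) ++
  flatten [seq enc_itemset (tnth (q_fam I) j) ++ enc_rat (tnth (q_theta I) j)
          | j <- enum 'I_(q_N I)].

(** The language of encoded yes-instances. The frequencies of a yes-instance
    are consistent in any case, since the witness satisfies them. *)
Definition MaxQueryDec (R : realType) (x : seq sym) : Prop :=
  exists I : query, [/\ x = encode I, admissible R I & exceeds R I].

(* Main.v *)
From mathcomp Require Import all_boot all_order all_algebra.
From mathcomp Require Import fingroup perm.
From mathcomp Require Import boolp reals zify.
Require Import Defs.

(** If some distribution answers the query, then so does one whose support is
    minimal; the columns of its support in the 0/1 constraint matrix are
    linearly independent, so there are at most N+1 of them and, by Cramer's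
    rule, all its probabilities are multiples of 1/D for some
    D <= (N+1)! * prod_i den(theta_i). A certificate lists the support vectors
    with their integer weights, which have polynomially many bits, together with
    Bezout coefficients witnessing that every rational of the input is in
    lowest terms.

    The verifier only manipulates natural numbers of polynomial size kept in
    unary: they index the input word and the certificate, and sums and products
    of long binary numbers are compared digit by digit with small carries. Such
    functions are closed under composition and polynomially bounded recursion,
    and are computed by programs that move read-only heads, one of them on the
    word and the others serving as counters; these programs are run step by step
    by a multi-tape Turing machine. *)

Set Implicit Arguments.
Unset Strict Implicit.
Unset Printing Implicit Defensive.

(** * Head-moving programs and Turing machines *)

(** The witness lives on 2^K points and its common denominator D may be exponentially large, so
    neither can be held in a counter. Long numbers therefore occur only as functions from positions
    to digits, and comparing two of them becomes a question about one carry. The same obstacle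
    explains the Bezout coefficients: the language contains only canonical encodings, and a gcd of
    long numbers is replaced by an identity v * den = u * num + 1 with guessed nonnegative u and v.

    The constants come from the input length n. The N+1 rows of the linear system are the N
    frequencies and the total mass, which takes the slot of the target, and N+1 <= n. With (N+1)! <=
    2^(n^2) and a product of denominators at most 2^n, D is below 2^((n+1)^2). This [width] also
    bounds the number of support vectors, of attributes and of entries, so that the whole
    certificate is one array of 4 * width^2 bits. Missing certificate bits read as 0, so every bit
    word can serve as a certificate and its format needs no check. *)

Section Machine.
Variable S : finType.

Notation cell := (tsym S unit).

(** [Cond true] is a while loop and [Cond false] a conditional without alternative. They share one
    constructor because they differ only in where the body exits. *)
Inductive cmd :=
  | Right of nat
  | Left of nat
  | Seq of cmd & cmd
  | Cond of bool & nat & pred cell & cmd.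

(** Head 0 scans the word. Every other tape has a single mark, at cell 0, so that its head position
    is a counter of which only vanishing can be observed. *)
Definition content (w : seq S) (i h : nat) : cell :=
  if i is 0 then nth None [seq Some (inl a) | a <- w] h
  else if h is 0 then Some (inr tt) else None.

Definition upd (st : nat -> nat) (i v : nat) : nat -> nat :=
  fun j => if j == i then v else st j.

(** [Left] has no rule at position 0: an execution never leaves the cells that [content]
    describes. *)
Inductive exec (w : seq S) :
    cmd -> (nat -> nat) -> (nat -> nat) -> nat -> Prop :=
  | ExecRight i st : exec w (Right i) st (upd st i (st i).+1) 1
  | ExecLeft i st v : st i = v.+1 -> exec w (Left i) st (upd st i v) 1
  | ExecSeq c1 c2 st1 st2 st3 t1 t2 :
      exec w c1 st1 st2 t1 -> exec w c2 st2 st3 t2 ->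
      exec w (Seq c1 c2) st1 st3 (t1 + t2)
  | ExecSkip l i (P : pred cell) c st : ~~ P (content w i (st i)) ->
      exec w (Cond l i P c) st st 1
  | ExecIf i (P : pred cell) c st st' t : P (content w i (st i)) -> exec w c st st' t ->
      exec w (Cond false i P c) st st' t.+1
  | ExecLoop i (P : pred cell) c st1 st2 st3 t1 t2 : P (content w i (st1 i)) ->
      exec w c st1 st2 t1 -> exec w (Cond true i P c) st2 st3 t2 ->
      exec w (Cond true i P c) st1 st3 (t1 + t2).+1.

Fixpoint heads_below (n : nat) (c : cmd) : bool :=
  match c with
  | Right i | Left i => i < n
  | Seq c1 c2 => heads_below n c1 && heads_below n c2
  | Cond _ i _ c => (i < n) && heads_below n c
  end.

Lemma heads_belowS m n c : m <= n -> heads_below m c -> heads_below n c.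
Proof.
move=> le_mn; elim: c => [i|i|c1 IH1 c2 IH2|l i P c IH] /=.
- by move/leq_trans; apply.
- by move/leq_trans; apply.
- by case/andP=> /IH1-> /IH2->.
- by case/andP=> lt_im /IH->; rewrite (leq_trans lt_im).
Qed.

Lemma heads_below_ex c : exists n, heads_below n c.
Proof.
elim: c => [i|i|c1 [n1 h1] c2 [n2 h2]|l i P c [n h]] /=; try by exists i.+1.
- exists (maxn n1 n2).
  by rewrite (heads_belowS (leq_maxl _ _) h1) (heads_belowS (leq_maxr _ _) h2).
- exists (maxn i.+1 n).
  by rewrite (heads_belowS (leq_maxr _ _) h) leq_maxl.
Qed.

(** These program points become the machine's states; the [None] added by [Cond] is its test. *)
Fixpoint point (c : cmd) : finType :=
  match c with
  | Right _ | Left _ => unit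
  | Seq c1 c2 => (point c1 + point c2)%type
  | Cond _ _ _ c => option (point c)
  end.

Fixpoint entry (c : cmd) : point c :=
  match c with
  | Right _ | Left _ => tt
  | Seq c1 c2 => inl (entry c1)
  | Cond _ _ _ c => None
  end.

Variable n : nat.

Notation tapes := ('I_n.+1 -> tape (S + unit)).
Notation reading := {ffun 'I_n.+1 -> cell}.

Definition reads (T : tapes) : reading := [ffun i => tread (T i)].

Definition shift (a : 'I_n.+1 -> move) (T : tapes) : tapes :=
  fun i => tmove (a i) (twrite (tread (T i)) (T i)).

Definition only (i : nat) (d : move) (j : 'I_n.+1) : move :=
  if j == i :> nat then d else Stay.

Definition stay (j : 'I_n.+1) : move := Stay.

(** A first component [None] signals exit. The exit of a subprogram is redirected at once to the
    following point or to the loop test, without an intermediate transition. *)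
Fixpoint next (c : cmd) :
    point c -> reading -> option (point c) * ('I_n.+1 -> move) :=
  match c return point c -> reading ->
                 option (point c) * ('I_n.+1 -> move) with
  | Right i => fun _ _ => (None, only i MoveR)
  | Left i => fun _ _ => (None, only i MoveL)
  | Seq c1 c2 => fun q r =>
      match q with
      | inl q1 => let: (q', a) := next q1 r in
          (Some (if q' is Some q1' then inl q1' else inr (entry c2)), a)
      | inr q2 => let: (q', a) := next q2 r in (omap inr q', a)
      end
  | Cond l i P c => fun q r =>
      match q with
      | None => (if P (r (inord i)) then Some (Some (entry c)) else None, stay)
      | Some q1 => let: (q', a) := next q1 r in
          (if q' is Some q1' then Some (Some q1')
           else if l then Some None else None, a)
      end
  end.

Inductive reach (c : cmd) : point c -> tapes -> tapes -> nat -> Prop :=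
  | ReachExit q T a : next q (reads T) = (None, a) -> reach q T (shift a T) 1
  | ReachStep q q' T T' a t : next q (reads T) = (Some q', a) ->
      reach q' (shift a T) T' t -> reach q T T' t.+1.

Lemma reach_seqr c1 c2 (q : point c2) T T' t :
  reach q T T' t -> @reach (Seq c1 c2) (inr q) T T' t.
Proof.
elim=> {q T T' t} [q T a e|q q' T T' a t e _ IH].
  by apply: ReachExit; rewrite /= e.
by apply: ReachStep IH; rewrite /= e.
Qed.

Lemma reach_seq c1 c2 (q : point c1) T1 T2 T3 t1 t2 :
  reach q T1 T2 t1 -> reach (entry c2) T2 T3 t2 ->
  @reach (Seq c1 c2) (inl q) T1 T3 (t1 + t2).
Proof.
elim=> {q T1 T2 t1} [q T a e|q q' T T' a t e _ IH] h; last first.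
  by rewrite addSn; apply: ReachStep (IH h); rewrite /= e.
by apply: ReachStep (reach_seqr c1 h); rewrite /= e.
Qed.

Lemma reach_if i P c (q : point c) T1 T2 t :
  reach q T1 T2 t -> @reach (Cond false i P c) (Some q) T1 T2 t.
Proof.
elim=> {q T1 T2 t} [q T a e|q q' T T' a t e _ IH].
  by apply: ReachExit; rewrite /= e.
by apply: ReachStep IH; rewrite /= e.
Qed.

Lemma reach_while i P c (q : point c) T1 T2 T3 t1 t2 :
  reach q T1 T2 t1 -> @reach (Cond true i P c) None T2 T3 t2 ->
  @reach (Cond true i P c) (Some q) T1 T3 (t1 + t2).
Proof.
elim=> {q T1 T2 t1} [q T a e|q q' T T' a t e _ IH] h; last first.
  by rewrite addSn; apply: ReachStep (IH h); rewrite /= e.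
by apply: ReachStep h; rewrite /= e.
Qed.

(* The cells to the left of position 0 are never visited, hence unconstrained. *)
Definition shows (X : Type) (g : nat -> option X) (h : nat) (t : tape X) :=
  (forall i, i < h -> nth None (tleft t) i = g (h - i.+1)) /\
  (forall i, nth None (tright t) i = g (h + i)).

Lemma shows_read X g h (t : tape X) : shows g h t -> tread t = g h.
Proof. by case=> _ /(_ 0); rewrite addn0 /tread nth0. Qed.

Lemma shows_stay X g h (t : tape X) :
  shows g h t -> shows g h (twrite (tread t) t).
Proof.
case=> hl hr; split=> //= -[|i] /=; last by rewrite nth_behead hr.
by rewrite -hr /tread nth0.
Qed.

Lemma shows_right X g h (t : tape X) :
  shows g h t -> shows g h.+1 (tmove MoveR (twrite (tread t) t)).
Proof.
move=> gt; case: (gt) => hl hr; split=> [[|i] /= hi|i] /=.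
- by rewrite subn1 /=; apply: shows_read gt.
- by rewrite subSS hl.
- by rewrite nth_behead hr addSnnS.
Qed.

Lemma shows_left X g h (t : tape X) :
  shows g h.+1 t -> shows g h (tmove MoveL (twrite (tread t) t)).
Proof.
move=> gt; case: (gt) => hl hr; split=> [i hi|[|i]] /=.
- by rewrite nth_behead hl // subSS.
- by rewrite -nth0 hl // subn1 addn0.
- case: i => [|i] /=; first by rewrite addn1; apply: shows_read gt.
  by rewrite nth_behead hr !addnS addSn.
Qed.

Definition coded (w : seq S) (st : nat -> nat) (T : tapes) :=
  forall i : 'I_n.+1, shows (content w i) (st i) (T i).

Lemma coded_read w st T i : i < n.+1 -> coded w st T ->
  reads T (inord i) = content w i (st i).
Proof. by move=> lt_in cT; rewrite ffunE (shows_read (cT _)) inordK. Qed.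

Lemma coded_stay w st T : coded w st T -> coded w st (shift stay T).
Proof. by move=> cT i; apply: shows_stay. Qed.

(** The times agree exactly because each elementary move and each test of [exec] is one transition
    of [next]. *)
Lemma exec_reach w c st st' t T :
  exec w c st st' t -> heads_below n.+1 c -> coded w st T ->
  exists2 T', reach (entry c) T T' t & coded w st' T'.
Proof.
move=> ex; elim: ex T => {c st st' t} /=.
- move=> i st T lt_in cT; exists (shift (only i MoveR) T); first exact: ReachExit.
  move=> j; rewrite /upd /shift /only; case: eqP => [<-|_].
    by apply: shows_right.
  exact: shows_stay.
- move=> i st v stv T lt_in cT; exists (shift (only i MoveL) T); first exact: ReachExit.
  move=> j; rewrite /upd /shift /only; case: eqP => [ij|_].
    by apply: shows_left; rewrite -stv -ij.
  exact: shows_stay.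
- move=> c1 c2 st1 st2 st3 t1 t2 _ IH1 _ IH2 T /andP[h1 h2] /(IH1 _ h1)[T2 r1].
  by move=> /(IH2 _ h2)[T3 r2 cT]; exists T3 => //; apply: reach_seq r1 r2.
- move=> l i P c st nP T /andP[lt_in _] cT.
  exists (shift stay T); last exact: coded_stay.
  by apply: ReachExit; rewrite /= (coded_read lt_in cT) (negPf nP).
- move=> i P c st st' t hP _ IH T /andP[lt_in hc] cT.
  have [T' r cT'] := IH _ hc (coded_stay cT); exists T' => //.
  apply: ReachStep (reach_if _ _ r).
  by rewrite /= (coded_read lt_in cT) hP.
- move=> i P c st1 st2 st3 t1 t2 hP _ IH1 _ IH2 T h cT.
  case/andP: (h) => lt_in hc.
  have [T2 r1 cT2] := IH1 _ hc (coded_stay cT).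
  have [T3 r2 cT3] := IH2 _ h cT2; exists T3 => //.
  apply: ReachStep (reach_while r1 r2).
  by rewrite /= (coded_read lt_in cT) hP.
Qed.

Section Decider.
Variables (c : cmd) (out : nat).

(* [None] starts, [Some (inl None)] inspects the counter [out], and
   [Some (inr b)] halts. *)
Definition decider_trans (q : option (option (point c) + bool)) (r : reading) :
    option (option (point c) + bool) * {ffun 'I_n.+1 -> cell * move} :=
  match q with
  | None => (Some (inl (Some (entry c))),
             [ffun i => (if i == ord0 then r i else Some (inr tt), Stay)])
  | Some (inl (Some q)) =>
      let: (q', a) := next q r in (Some (inl q'), [ffun i => (r i, a i)])
  | Some (inl None) =>
      (Some (inr (r (inord out) != Some (inr tt))), [ffun i => (r i, Stay)])
  | Some (inr b) => (Some (inr b), [ffun i => (r i, Stay)])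
  end.

Definition decider : tm S :=
  @Tm S unit n (option (option (point c) + bool)) None
    (fun q => if q is Some (inr b) then Some b else None) decider_trans.

Lemma decider_run (q : point c) T T' t : reach q T T' t ->
  iter t (@step S decider) (Some (inl (Some q)), T) = (Some (inl None), T').
Proof.
elim=> {q T T' t} [q T a e|q q' T T' a t e _ IH].
  rewrite /= /step /= -/(reads T) e; congr pair.
  by apply: funext => i; rewrite !ffunE.
rewrite iterSr -IH; congr iter; rewrite /step /= -/(reads T) e.
by congr pair; apply: funext => i; rewrite !ffunE.
Qed.

(** The two additional steps write the marks of the counters and inspect the counter [out], which
    cannot be tape 0 since that tape has no mark. *)
Lemma decider_outcome w st t :
  exec w c (fun=> 0) st t -> heads_below n.+1 c -> 0 < out < n.+1 ->
  outcome decider w t.+2 = Some (st out != 0).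
Proof.
move=> ex hc /andP[out_gt0 lt_out].
pose T0 : tapes := (step (init decider w)).2.
have cT0 : coded w (fun=> 0) T0.
  move=> i; rewrite /T0 /init /step /= !ffunE -val_eqE /=; split=> // j.
  clear; case: i => [[|i] lt_i] /=.
    by case: w => [|a v]; case: j => [|j] //=; rewrite nth_nil.
  by case: j => [|j] //=; rewrite nth_nil.
have [T' r cT'] := exec_reach ex hc cT0.
rewrite /outcome iterS iterSr -[step (init decider w)]/(Some (inl (Some (entry c))), T0).
rewrite (decider_run r) /= /step /= -/(reads T') (coded_read lt_out cT').
by case: out out_gt0 {lt_out} => // o _ /=; case: (st _).
Qed.

End Decider.
End Machine.

(** * Functions on words computed in polynomial time *)

(** The base is at least 2 even for [m = 0], so constants, sums and products are all absorbed by
    raising the exponent. *)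
Definition pbound (g : nat -> nat) := exists k, forall m, g m <= m.+2 ^ k.

Lemma pbound_le g h : (forall m, g m <= h m) -> pbound h -> pbound g.
Proof. by move=> le_gh [k hk]; exists k => m; apply: leq_trans (hk m). Qed.

Lemma pbound_id : pbound id.
Proof. by exists 1 => m; rewrite expn1; lia. Qed.

Lemma pbound_const c : pbound (fun=> c).
Proof.
by exists c => m; rewrite ltnW // ltn_expl.
Qed.

Lemma pbound_mul g h : pbound g -> pbound h -> pbound (fun m => g m * h m).
Proof.
by move=> [k hk] [l hl]; exists (k + l) => m; rewrite expnD leq_mul.
Qed.

Lemma pbound_add g h : pbound g -> pbound h -> pbound (fun m => g m + h m).
Proof.
move=> [k hk] [l hl]; exists (k + l).+1 => m; rewrite expnS expnD.
have k_gt0 : 0 < m.+2 ^ k by rewrite expn_gt0.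
have l_gt0 : 0 < m.+2 ^ l by rewrite expn_gt0.
by have := hk m; have := hl m; nia.
Qed.

Lemma pbound_comp g h : pbound g -> pbound h -> pbound (fun m => g (h m)).
Proof.
move=> [k hk] [l hl]; exists (l.+2 * k) => m; rewrite expnM.
(* For x = (m+2)^l one has x + 2 <= 4x <= (m+2)^2 * x, whence the exponent l + 2. *)
apply: leq_trans (hk _) _; case: k {hk} => // k; rewrite leq_exp2r // !expnS.
have l_gt0 : 0 < m.+2 ^ l by rewrite expn_gt0.
by have := hl m; nia.
Qed.

(** Variables are de Bruijn indices: binding a value puts it at index 0 and shifts the others. *)
Definition scons (v : nat) (s : nat -> nat) (i : nat) : nat :=
  if i is j.+1 then s j else v.

Section Programs.
Variable S : finType.
Implicit Types (w : seq S) (st s r : nat -> nat) (c : cmd S).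

Definition run w c st st' T := exists2 t, t <= T & exec w c st st' t.

Lemma run_le w c st st' T T' : T <= T' -> run w c st st' T -> run w c st st' T'.
Proof. by move=> le_T [t le_t e]; exists t => //; apply: leq_trans le_T. Qed.

Lemma run_seq w c1 c2 st1 st2 st3 T1 T2 :
  run w c1 st1 st2 T1 -> run w c2 st2 st3 T2 -> run w (Seq c1 c2) st1 st3 (T1 + T2).
Proof.
move=> [t1 le1 e1] [t2 le2 e2]; exists (t1 + t2); first exact: leq_add.
exact: ExecSeq e1 e2.
Qed.

Lemma run_right w i st : run w (Right S i) st (upd st i (st i).+1) 1.
Proof. by exists 1 => //; apply: ExecRight. Qed.

Lemma run_left w i st v : st i = v.+1 -> run w (Left S i) st (upd st i v) 1.
Proof. by exists 1 => //; apply: ExecLeft. Qed.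

(** [F j] is the state after j rounds. Each round pays for its body and one test, and the last unit
    is the failing test. *)
Lemma run_loop w i (P : pred (tsym S unit)) c (F : nat -> nat -> nat) x T :
  (forall j, j < x -> P (content w i (F j i))) ->
  ~~ P (content w i (F x i)) ->
  (forall j, j < x -> run w c (F j) (F j.+1) T) ->
  run w (Cond true i P c) (F 0) (F x) (x * T.+1).+1.
Proof.
elim: x F => [|x IH] F hP nP hF.
  by exists 1 => //; apply: ExecSkip.
have [t1 le1 e1] := hF 0 isT.
have [||t2 le2 e2] := IH (fun j => F j.+1) _ nP _.
- by move=> j ltjx; apply: hP.
- by move=> j ltjx; apply: hF.
exists (t1 + t2).+1; first by rewrite mulSn; lia.
by apply: ExecLoop e1 e2; apply: hP.
Qed.

Definition pos (x : tsym S unit) : bool := x != Some (inr tt).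

Lemma pos_content w i h : 0 < i -> pos (content w i h) = (h != 0).
Proof. by case: i => // i _; case: h. Qed.

Definition drain (i : nat) := Cond true i pos (Left S i).

Lemma run_drain w i st : 0 < i -> run w (drain i) st (upd st i 0) ((st i) * 2).+1.
Proof.
move=> i_gt0; pose F j := upd st i (st i - j).
have -> : st = F 0 by apply: funext => a; rewrite /F /upd subn0; case: eqP => [->|].
have -> : upd (F 0) i 0 = F (st i).
  by apply: funext => a; rewrite /F /upd subnn; case: eqP.
have -> : F 0 i = st i by rewrite /F /upd eqxx subn0.
apply: run_loop => [j ltj||j ltj].
- by rewrite pos_content // /F /upd eqxx; lia.
- by rewrite pos_content // /F /upd eqxx subnn.
rewrite (_ : F j.+1 = upd (F j) i (st i - j.+1)).
  by apply: run_left; rewrite /F /upd eqxx; lia.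
by apply: funext => a; rewrite /F /upd; case: eqP.
Qed.

Definition transfer (i j : nat) := Cond true i pos (Seq (Left S i) (Right S j)).

Lemma run_transfer w i j st : 0 < i -> i != j ->
  run w (transfer i j) st (upd (upd st i 0) j (st j + st i)) ((st i) * 3).+1.
Proof.
move=> i_gt0 ij; pose F l := upd (upd st i (st i - l)) j (st j + l).
have Fi l : F l i = st i - l by rewrite /F /upd (negPf ij) eqxx.
have Fj l : F l j = st j + l by rewrite /F /upd eqxx.
have -> : upd (upd st i 0) j (st j + st i) = F (st i) by rewrite /F subnn.
rewrite {1}(_ : st = F 0); last first.
  apply: funext => a; rewrite /F /upd subn0 addn0.
  by repeat (case: (_ =P _) => [->|_] //).
apply: run_loop => [l ltl||l ltl]; rewrite ?pos_content ?Fi //; try lia.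
apply: (@run_seq _ _ _ _ (upd (F l) i (st i - l.+1)) _ 1 1).
  by apply: run_left; rewrite Fi; lia.
rewrite (_ : F l.+1 = upd (upd (F l) i (st i - l.+1)) j
  (upd (F l) i (st i - l.+1) j).+1); first exact: run_right.
apply: funext => a; rewrite /F /upd.
by repeat (case: (_ =P _) => ?); subst; lia.
Qed.

(** Reading a counter destroys it, so the value is drained into [d] and [d.+1] at once and then
    restored from [d.+1]. *)
Definition copy (i d : nat) :=
  Seq (Cond true i pos (Seq (Left S i) (Seq (Right S d) (Right S d.+1))))
      (transfer d.+1 i).

Lemma run_copy w i d st : 0 < i -> i < d -> st d = 0 -> st d.+1 = 0 ->
  run w (copy i d) st (upd st d (st i)) (((st i) * 4).+1 + ((st i) * 3).+1).
Proof.
move=> i_gt0 lt_id d0 d1.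
pose F l := upd (upd (upd st i (st i - l)) d l) d.+1 l.
have Fi l : F l i = st i - l by rewrite /F /upd eqxx !ltn_eqF //; lia.
have F1 l : F l d.+1 = l by rewrite /F /upd eqxx.
have Fd l : F l d = l by rewrite /F /upd eqxx ltn_eqF.
apply: (@run_seq _ _ _ _ (F (st i))).
  rewrite {1}(_ : st = F 0); last first.
    apply: funext => a; rewrite /F /upd subn0.
    by repeat (case: (_ =P _) => [->|_] //).
  apply: run_loop => [l ltl||l ltl]; rewrite ?pos_content ?Fi //; try lia.
  pose st1 := upd (F l) i (st i - l.+1).
  apply: (@run_seq _ _ _ _ st1 _ 1 2).
    by apply: run_left; rewrite Fi; lia.
  apply: (@run_seq _ _ _ _ (upd st1 d (st1 d).+1) _ 1 1); first exact: run_right.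
  rewrite (_ : F l.+1 = upd (upd st1 d (st1 d).+1) d.+1
     (upd st1 d (st1 d).+1 d.+1).+1); first exact: run_right.
  apply: funext => a; rewrite /st1 /upd /F /upd eqxx.
  by repeat (case: (_ =P _) => ?); lia.
have := @run_transfer w d.+1 i (F (st i)) isT; rewrite F1 Fi.
rewrite (_ : upd _ _ _ = upd st d (st i)); first by apply; lia.
apply: funext => a; rewrite /upd /F /upd.
repeat (case: (_ =P _) => ?); subst; lia.
Qed.

(** Stack discipline: the word's head is at home and the registers from [d] on are free scratch
    space. *)
Definition fresh (d : nat) st := [/\ st 0 = 0, st 1 = 0 & forall i, d <= i -> st i = 0].

(* Register 1 always holds 0; it is the target of unused variables. *)
Definition compiles (f : seq S -> (nat -> nat) -> nat) (g : nat -> nat) r d c :=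
  forall w st m, size w <= m -> (forall i, st i <= m) -> fresh d st ->
  run w c st (upd st d (f w (fun i => st (r i)))) (g m).

Definition bounded (f : seq S -> (nat -> nat) -> nat) (g : nat -> nat) :=
  forall w s m, size w <= m -> (forall i, s i <= m) -> f w s <= g m.

(** [r] places the variables and [d] is the first free register. Code must exist for every
    placement, so that it can be nested; one bound [g], fixed before the placement, covers both
    values and running time. *)
Definition poly (f : seq S -> (nat -> nat) -> nat) := exists g,
  [/\ pbound g, bounded f g & forall r d, 1 < d -> (forall i, 0 < r i < d) ->
      exists c, compiles f g r d c].

Lemma poly_bounded f : poly f -> exists2 g, pbound g & bounded f g.
Proof. by case=> g [hg bg _]; exists g. Qed.

Lemma poly_var i : poly (fun w s => s i).
Proof.
exists (fun m => (m * 4).+1 + (m * 3).+1); split.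
- apply: (@pbound_le _ (fun m => m * 7 + 2)) => [m|]; first lia.
  apply: pbound_add (pbound_const _); exact: pbound_mul pbound_id (pbound_const _).
- by move=> w s m _ /(_ i); lia.
move=> r d d_gt1 hr; exists (copy (r i) d) => w st m _ hst [_ _ fr].
have /andP[r_gt0 lt_rd] := hr i.
by apply: run_le (run_copy _ r_gt0 lt_rd (fr d _) (fr _ _)) => //; have := hst (r i); lia.
Qed.

Lemma poly_0 : poly (fun w s => 0).
Proof.
exists (fun=> 1); split=> [||r d d_gt1 _]; [exact: pbound_const|by []|].
exists (Cond false 1 pos (Right S 1)) => w st m _ _ [_ st1 fr].
rewrite (_ : upd st d 0 = st); first by exists 1 => //; apply: ExecSkip; rewrite st1.
by apply: funext => i; rewrite /upd; case: eqP => // ->; rewrite fr.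
Qed.

Lemma poly_succ f : poly f -> poly (fun w s => (f w s).+1).
Proof.
case=> g [hg bf cf]; exists (fun m => g m + 1); split.
- exact: pbound_add hg (pbound_const _).
- by move=> w s m hw hs; rewrite addn1 ltnS bf.
move=> r d d_gt1 hr; have [c hc] := cf r d d_gt1 hr.
exists (Seq c (Right S d)) => w st m hw hst fr.
apply: run_seq (hc _ _ _ hw hst fr) _.
set st1 := upd st d _; have := run_right w d st1.
rewrite (_ : upd st1 d _ = upd st d (f w (fun i => st (r i))).+1) //.
by apply: funext => i; rewrite /st1 /upd eqxx; case: eqP.
Qed.

Lemma poly_ren (xi : nat -> nat) f : poly f -> poly (fun w s => f w (fun i => s (xi i))).
Proof.
case=> g [hg bf cf]; exists g; split=> // [w s m hw hs|r d d_gt1 hr]; first exact: bf.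
have [|c hc] := cf (fun i => r (xi i)) d d_gt1; first by move=> i; apply: hr.
by exists c.
Qed.

Lemma scons_read v d r st : (forall i, r i < d) -> fresh d st ->
  (fun i => upd st d v (scons d r i)) = scons v (fun i => st (r i)).
Proof.
move=> hr fr; apply: funext => -[|i] /=; rewrite /upd ?eqxx //.
by rewrite ltn_eqF.
Qed.

Lemma fresh_upd d st v : 1 < d -> fresh d st -> fresh d.+1 (upd st d v).
Proof.
move=> d_gt1 [s0 s1 fr]; split; rewrite /upd ?ltn_eqF //; try lia.
by move=> i lt_di; rewrite gtn_eqF // fr // ltnW.
Qed.

Lemma upd_le d st v m m' :
  (forall i, st i <= m) -> m <= m' -> v <= m' -> forall i, upd st d v i <= m'.
Proof.
by move=> hst le_m le_v i; rewrite /upd; case: eqP => // _; apply: leq_trans le_m.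
Qed.

(** The value of [g] stays in [d] as variable 0 while [f] is computed into [d.+1]; then [d] is
    emptied and the result moved down. *)
Lemma poly_let f g : poly f -> poly g -> poly (fun w s => f w (scons (g w s) s)).
Proof.
case=> bf [pf vf cf] [bg [pg vg cg]].
pose e m := m + bg m.
exists (fun m => bg m + (bf (e m) + ((bg m * 2).+1 + ((bf (e m)) * 3).+1))).
have le_e m : m <= e m by rewrite /e leq_addr.
have vf' w s m : size w <= m -> (forall i, s i <= m) ->
    f w (scons (g w s) s) <= bf (e m).
  move=> hw hs; apply: vf => [|[|i] /=]; first exact: leq_trans (le_e m).
    by rewrite /e (leq_trans (vg _ _ _ hw hs)) // leq_addl.
  exact: leq_trans (hs i) (le_e m).
split=> [|w s m hw hs|r d d_gt1 hr].
- have pe : pbound (fun m => bf (e m)).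
    by apply: pbound_comp => //; apply: pbound_add pbound_id pg.
  apply: (@pbound_le _ (fun m => bg m * 3 + (bf (e m) * 4 + 2))) => [m|]; first lia.
  by repeat first [apply: pbound_add | apply: pbound_mul | apply: pbound_const].
- by have := vf' w s m hw hs; lia.
have [c1 hc1] := cg r d d_gt1 hr.
have [||c2 hc2] := cf (scons d r) d.+1; first exact: leqW.
  by case=> [|i] /=; [lia | have := hr i; lia].
exists (Seq c1 (Seq c2 (Seq (drain d) (transfer d.+1 d)))) => w st m hw hst fr.
set s := fun i => st (r i).
have hs i : s i <= m by apply: hst.
apply: run_seq (hc1 _ _ _ hw hst fr) _; rewrite -/s; set st1 := upd st d _.
have := hc2 w st1 (e m) (leq_trans hw (le_e m)) _ (fresh_upd _ d_gt1 fr).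
rewrite scons_read => [|i|//]; last by case/andP: (hr i).
rewrite -/s => hc2'; apply: run_seq (hc2' _) _.
  apply: upd_le hst (le_e m) _.
  by rewrite /e (leq_trans (vg _ _ _ hw hs)) // leq_addl.
set st2 := upd st1 d.+1 _.
have st2d : st2 d = g w s by rewrite /st2 /st1 /upd eqxx ltn_eqF.
have := run_drain w st2 (ltnW d_gt1); rewrite st2d => hd.
apply: run_seq (run_le _ hd) _; first by have := vg w s m hw hs; lia.
set st3 := upd st2 d 0.
have st3d : st3 d.+1 = f w (scons (g w s) s) by rewrite /st3 /st2 /upd eqxx gtn_eqF.
have := @run_transfer w d.+1 d st3 isT; rewrite st3d => ht.
have {}ht := ht ltac:(lia).
rewrite (_ : upd _ d _ = upd st d (f w (scons (g w s) s))) in ht.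
  by apply: run_le ht; have := vf' w s m hw hs; lia.
case: fr => _ _ fr; apply: funext => i; rewrite /st3 /st2 /st1 /upd eqxx.
by repeat (case: (_ =P _) => ?); subst; first [by [] | lia | by rewrite fr //; lia].
Qed.

Definition iterate (F : seq S -> (nat -> nat) -> nat -> nat -> nat)
    (a : seq S -> (nat -> nat) -> nat) w s j :=
  iteri j (fun i x => F w s i x) (a w s).

(** Iterating a polynomial step can grow exponentially, as repeated doubling shows; hence the
    separate bound on all intermediate values, as in Cobham's bounded recursion. *)
Lemma poly_rec F n a :
  poly n -> poly a -> poly (fun w s => F w (fun i => s i.+2) (s 1) (s 0)) ->
  (exists2 h, pbound h & forall w s m, size w <= m -> (forall i, s i <= m) ->
     forall j, j <= n w s -> iterate F a w s j <= h m) ->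
  poly (fun w s => iteri (n w s) (fun i x => F w s i x) (a w s)).
Proof.
case=> bn [pn vn cn] [ba [pa va ca]] [bF [pF vF cF]] [h ph vh].
pose e1 m := m + bn m; pose e m := m + (bn m + h m).
pose tb m := 1 + (bF (e m) + ((h m * 2).+1 + ((h m * 3).+1 + 1))).
exists (fun m => bn m + (ba (e1 m) + ((bn m * (tb m).+1).+1 +
   ((bn m * 2).+1 + (h m * 3).+1)))).
have le_e1 m : m <= e1 m by rewrite /e1 leq_addr.
have le_e m : m <= e m by rewrite /e leq_addr.
split=> [|w s m hw hs|r d d_gt1 hr].
- have p1 : pbound (fun m => ba (e1 m)).
    by apply: pbound_comp => //; apply: pbound_add pbound_id pn.
  have p2 : pbound (fun m => bF (e m)).
    apply: pbound_comp => //; apply: pbound_add pbound_id _.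
    exact: pbound_add pn ph.
  apply: (@pbound_le _ (fun m => bn m + (ba (e1 m) + ((bn m * (bF (e m) + (h m * 5 + 5)) + 1) +
    (bn m * 2 + (h m * 3 + 2)))))) => [m|]; first by rewrite /tb; nia.
  by repeat first [apply: pbound_add | apply: pbound_mul | apply: pbound_const].
- by have := vh w s m hw hs (n w s) (leqnn _); rewrite /iterate; lia.
have [c1 hc1] := cn r d d_gt1 hr.
have [||c2 hc2] := ca r d.+1; first exact: leqW.
  by move=> i; have := hr i; lia.
have [||c3 hc3] := cF (scons d.+1 (scons d.+2 r)) d.+3; first lia.
  by case=> [|[|i]] /=; [lia | lia | have := hr i; lia].
(* Register [d] counts the remaining rounds, [d.+1] holds the accumulator, [d.+2] the round index,
   and [d.+3] receives the new accumulator. *)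
exists (Seq c1 (Seq c2 (Seq
  (Cond true d pos (Seq (Left S d) (Seq c3 (Seq (drain d.+1)
       (Seq (transfer d.+3 d.+1) (Right S d.+2))))))
  (Seq (drain d.+2) (transfer d.+1 d))))) => w st m hw hst fr.
set s := fun i => st (r i).
have hs i : s i <= m by apply: hst.
have hn := vn w s m hw hs.
case: (fr) => st0 st1 std.
apply: run_seq (hc1 _ _ _ hw hst fr) _; rewrite -/s.
set stA := upd st d _.
have hA i : stA i <= e1 m by apply: upd_le hst _ _ _ => //; rewrite /e1; lia.
have := hc2 w stA (e1 m) (leq_trans hw (le_e1 m)) hA (fresh_upd _ d_gt1 fr).
have -> : (fun i => stA (r i)) = s.
  by apply: funext => i; rewrite /stA /upd ltn_eqF //; have := hr i; lia.
move=> hc2'; apply: run_seq hc2' _; set stB := upd stA _ _.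
pose N := n w s.
pose it j := iterate F a w s j.
have it_le j : j <= N -> it j <= h m by apply: vh.
pose G j := upd (upd (upd st d (N - j)) d.+1 (it j)) d.+2 j.
have Gd j : G j d = N - j by rewrite /G /upd eqxx !ltn_eqF.
have G1 j : G j d.+1 = it j by rewrite /G /upd eqxx ltn_eqF.
have G2 j : G j d.+2 = j by rewrite /G /upd eqxx.
have -> : stB = G 0.
  apply: funext => i; rewrite /stB /stA /G /upd subn0 -/N.
  by repeat (case: (_ =P _) => ?); subst; first [by [] | lia | by rewrite !std //; lia].
apply: (@run_seq _ _ _ _ (G N)).
  apply: run_le (@run_loop _ _ _ _ G N (tb m) _ _ _).
  - by have : N * (tb m).+1 <= bn m * (tb m).+1 by rewrite leq_mul2r hn orbT.
  - by move=> j ltj; rewrite pos_content ?Gd; lia.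
  - by rewrite pos_content ?Gd; lia.
  move=> j ltj; pose G' := upd (G j) d (N - j.+1).
  apply: (@run_seq _ _ _ _ G'); first by apply: run_left; rewrite Gd; lia.
  have frG : fresh d.+3 G'.
    split; rewrite /G' /G /upd; repeat (case: (_ =P _) => ?); try lia.
    move=> i lti; repeat (case: (_ =P _) => ?); try lia.
    by apply: std; lia.
  have := hc3 w G' (e m) (leq_trans hw (le_e m)) _ frG.
  rewrite /= (_ : (fun i => G' (r i)) = s); last first.
    apply: funext => i; rewrite /G' /G /upd.
    by have := hr i; repeat (case: (_ =P _) => ?); try lia.
  have -> : G' d.+2 = j by rewrite /G' /upd gtn_eqF // G2.
  have -> : G' d.+1 = it j by rewrite /G' /upd gtn_eqF // G1.
  rewrite (_ : F w s j (it j) = it j.+1) // => hc3'.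
  apply: run_seq (hc3' _) _.
    move=> i; rewrite /G' /G /upd; have := it_le j (ltnW ltj); have := hst i.
    by rewrite /e; repeat (case: (_ =P _) => ?); lia.
  set H := upd G' _ _.
  have H1 : H d.+1 = it j by rewrite /H /G' /upd ltn_eqF // gtn_eqF // G1.
  have := @run_drain w d.+1 H isT; rewrite H1 => hd.
  apply: run_seq (run_le _ hd) _; first by have := it_le j (ltnW ltj); lia.
  set H' := upd H _ _.
  have H'3 : H' d.+3 = it j.+1 by rewrite /H' /H /upd eqxx gtn_eqF.
  have := @run_transfer w d.+3 d.+1 H' isT; rewrite H'3 => ht.
  have {}ht := ht ltac:(lia).
  apply: run_seq (run_le _ ht) _; first by have := it_le j.+1 ltj; lia.
  set H'' := upd _ d.+1 _.
  rewrite (_ : G j.+1 = upd H'' d.+2 (H'' d.+2).+1); first exact: run_right.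
  apply: funext => i; rewrite /H'' /H' /H /G' /G /upd.
  by repeat (case: (_ =P _) => ?); subst; first [by [] | lia | by rewrite !std //; lia].
have := @run_drain w d.+2 (G N) isT; rewrite G2 => hd.
apply: run_seq (run_le _ hd) _; first by rewrite /N; lia.
set H := upd _ _ _.
have Hd1 : H d.+1 = it N by rewrite /H /upd ltn_eqF // G1.
have Hd0 : H d = 0 by rewrite /H /upd ltn_eqF // Gd subnn.
have := @run_transfer w d.+1 d H isT; rewrite Hd1 Hd0 => ht.
have {}ht := ht ltac:(lia).
rewrite (_ : upd _ d _ = upd st d (it N)) in ht.
  by apply: run_le ht; have := it_le N (leqnn _); lia.
apply: funext => i; rewrite /H /G /upd.
by repeat (case: (_ =P _) => ?); subst; first [by [] | lia | by rewrite !std //; lia].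
Qed.

Definition blank (x : tsym S unit) : bool := x == None.

Lemma content_word w h : content w 0 h = omap inl (onth w h).
Proof. by rewrite -onth_map onthE -map_comp. Qed.

(** The left end of tape 0 is unmarked, so a second counter measures the way back. *)
Lemma poly_size : poly (fun w s => size w).
Proof.
exists (fun m => (m * 4).+1 + (m * 3).+1); split=> [|w s m hw hs|r d d_gt1 hr].
- apply: (@pbound_le _ (fun m => m * 7 + 2)) => [m|]; first lia.
  apply: pbound_add (pbound_const _); exact: pbound_mul pbound_id (pbound_const _).
- lia.
exists (Seq (Cond true 0 (predC blank) (Seq (Right S d) (Seq (Right S d.+1) (Right S 0))))
            (Cond true d.+1 pos (Seq (Left S d.+1) (Left S 0)))) => w st m hw hst [st0 st1 std].
pose F l := upd (upd (upd st d l) d.+1 l) 0 l.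
have F0 l : F l 0 = l by [].
have Fd l : F l d = l by rewrite /F /upd; repeat (case: (_ =P _) => ?); lia.
have F1 l : F l d.+1 = l by rewrite /F /upd eqxx.
apply: (@run_seq _ _ _ _ (F (size w))).
  rewrite {1}(_ : st = F 0); last first.
    apply: funext => a; rewrite /F /upd.
    by repeat (case: (_ =P _) => ?); subst; first [by [] | lia | by rewrite !std //; lia].
  apply: run_le (@run_loop _ _ _ _ F (size w) 3 _ _ _); first lia.
  - by move=> j ltj; rewrite F0 content_word /= /blank; move: ltj; rewrite -onthTE; case: onth.
  - by rewrite F0 content_word /= /blank onth_default.
  move=> l ltl.
  pose sta := upd (F l) d (F l d).+1.
  apply: (@run_seq _ _ _ _ sta _ 1 2); first exact: run_right.
  pose stb := upd sta d.+1 (sta d.+1).+1.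
  apply: (@run_seq _ _ _ _ stb _ 1 1); first exact: run_right.
  rewrite (_ : F l.+1 = upd stb 0 (stb 0).+1); first exact: run_right.
  apply: funext => a; rewrite /stb /sta Fd /F /upd.
  by repeat (case: (_ =P _) => ?); subst; lia.
pose G l := upd (upd (upd st d (size w)) d.+1 (size w - l)) 0 (size w - l).
have G0 l : G l 0 = size w - l by [].
have G1 l : G l d.+1 = size w - l by rewrite /G /upd eqxx.
have -> : F (size w) = G 0 by rewrite /F /G subn0.
have -> : upd st d (size w) = G (size w).
  apply: funext => a; rewrite /G /upd subnn.
  by repeat (case: (_ =P _) => ?); subst; first [by [] | lia | by rewrite !std //; lia].
apply: run_le (@run_loop _ _ _ _ G (size w) 2 _ _ _); first lia.
- by move=> j ltj; rewrite pos_content // G1; lia.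
- by rewrite pos_content // G1; lia.
move=> l ltl; pose st2 := upd (G l) d.+1 (size w - l.+1).
apply: (@run_seq _ _ _ _ st2 _ 1 1).
  by apply: run_left; rewrite G1; lia.
rewrite (_ : G l.+1 = upd st2 0 (size w - l.+1)).
  by apply: run_left; rewrite /st2 /upd /= G0; lia.
apply: funext => a; rewrite /st2 /G /upd.
by repeat (case: (_ =P _) => ?); subst; lia.
Qed.

Lemma poly_sym (P : pred (option S)) f :
  poly f -> poly (fun w s => P (onth w (f w s))).
Proof.
case=> g [hg bf cf].
exists (fun m => g m + ((g m * 4).+1 + (2 + (g m * 3).+1))); split=> [|w s m hw hs|r d d_gt1 hr].
- apply: (@pbound_le _ (fun m => g m * 8 + 4)) => [m|]; first lia.
  apply: pbound_add (pbound_const _); exact: pbound_mul hg (pbound_const _).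
- by case: (P _); lia.
have [c hc] := cf r d d_gt1 hr.
(* A blank cell becomes [None], which is what [onth] returns past the end of the word. *)
pose P' (x : tsym S unit) := P (obind (fun y => if y is inl a then Some a else None) x).
exists (Seq c (Seq (Cond true d pos (Seq (Left S d) (Seq (Right S d.+1) (Right S 0))))
        (Seq (Cond false 0 P' (Right S d))
           (Cond true d.+1 pos (Seq (Left S d.+1) (Left S 0)))))) => w st m hw hst fr.
set v := f w _; have le_v : v <= g m by apply: bf.
case: (fr) => st0 st1 std.
apply: run_seq (hc _ _ _ hw hst fr) _; rewrite -/v.
pose F l := upd (upd (upd st d (v - l)) d.+1 l) 0 l.
have F0 l : F l 0 = l by [].
have Fd l : F l d = v - l by rewrite /F /upd; repeat (case: (_ =P _) => ?); lia.
have F1 l : F l d.+1 = l by rewrite /F /upd eqxx.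
apply: (@run_seq _ _ _ _ (F v)).
  rewrite {1}(_ : upd st d v = F 0); last first.
    apply: funext => a; rewrite /F /upd.
    by repeat (case: (_ =P _) => ?); subst; first [by [] | lia | by rewrite !std //; lia].
  apply: run_le (@run_loop _ _ _ _ F v 3 _ _ _); first lia.
  - by move=> j ltj; rewrite pos_content ?Fd; lia.
  - by rewrite pos_content ?Fd; lia.
  move=> l ltl; pose sta := upd (F l) d (v - l.+1).
  apply: (@run_seq _ _ _ _ sta _ 1 2).
    by apply: run_left; rewrite Fd; lia.
  pose stb := upd sta d.+1 (sta d.+1).+1.
  apply: (@run_seq _ _ _ _ stb _ 1 1); first exact: run_right.
  rewrite (_ : F l.+1 = upd stb 0 (stb 0).+1); first exact: run_right.
  apply: funext => a; rewrite /stb /sta /F /upd.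
  by repeat (case: (_ =P _) => ?); subst; lia.
pose b : nat := P (onth w v).
pose G l := upd (upd (upd st d b) d.+1 (v - l)) 0 (v - l).
have G0 l : G l 0 = v - l by [].
have G1 l : G l d.+1 = v - l by rewrite /G /upd eqxx.
apply: (@run_seq _ _ _ _ (G 0)).
  have Pv : P' (content w 0 (F v 0)) = P (onth w v).
    by rewrite F0 content_word /P'; case: (onth w v).
  case: (boolP (P (onth w v))) => Pw.
    exists 2 => //; apply: ExecIf; first by rewrite Pv.
    rewrite (_ : G 0 = upd (F v) d (F v d).+1); first exact: ExecRight.
    apply: funext => a; rewrite /F /G /upd /b Pw.
    by repeat (case: (_ =P _) => ?); subst; lia.
  exists 1 => //; rewrite (_ : G 0 = F v); first by apply: ExecSkip; rewrite Pv.
  apply: funext => a; rewrite /F /G /upd /b (negPf Pw).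
  by repeat (case: (_ =P _) => ?); subst; lia.
have -> : upd st d b = G v.
  apply: funext => a; rewrite /G /upd subnn.
  by repeat (case: (_ =P _) => ?); subst; first [by [] | lia | by rewrite !std //; lia].
apply: run_le (@run_loop _ _ _ _ G v 2 _ _ _); first lia.
- by move=> j ltj; rewrite pos_content // G1; lia.
- by rewrite pos_content // G1; lia.
move=> l ltl; pose st2 := upd (G l) d.+1 (v - l.+1).
apply: (@run_seq _ _ _ _ st2 _ 1 1).
  by apply: run_left; rewrite G1; lia.
rewrite (_ : G l.+1 = upd st2 0 (v - l.+1)).
  by apply: run_left; rewrite /st2 /upd /= G0; lia.
apply: funext => a; rewrite /st2 /G /upd.
by repeat (case: (_ =P _) => ?); subst; lia.
Qed.
End Programs.

Lemma poly_in_P (S : finType) (b : seq S -> bool) :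
  poly (fun w _ => b w) -> in_P (fun w => b w).
Proof.
(* There are no variables: all are sent to register 1, which is 0, and the answer lands in register
   2. *)
case=> g [[k hk] _ cg]; have [//|c hc] := cg (fun=> 1) 2 isT.
have [n hn] := heads_below_ex c.
pose N := maxn n 2; have hN : heads_below N.+1 c.
  by apply: heads_belowS hn; rewrite leqW ?leq_maxl.
exists (decider N c 2), (('X + polyC 2%N) ^+ k + polyC 2%N)%R => w.
have [//|//|t le_t ex] := hc w (fun=> 0) (size w) (leqnn _).
exists t.+2; split.
  rewrite hornerD horner_exp hornerD hornerX !hornerC.
  rewrite (_ : (_ ^+ k)%R = (size w).+2 ^ k); last first.
    by elim: k {hk} => // k IH; rewrite GRing.exprS expnS IH -[(_ + _)%R]/(_ + 2) addn2.
  by rewrite -[(_ + _)%R]/(_ + _)%N addn2 !ltnS (leq_trans le_t).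
exists (b w); split=> //; rewrite (decider_outcome ex hN) /upd ?eqxx //.
  by case: (b w).
by rewrite /N /=; lia.
Qed.

(** * Closure under arithmetic, Boolean operations and bounded quantifiers *)

Section Arithmetic.
Variable S : finType.
Implicit Types f g h : seq S -> (nat -> nat) -> nat.
Implicit Types b c : seq S -> (nat -> nat) -> bool.

Lemma poly_const n : poly (fun (w : seq S) s => n).
Proof. by elim: n => [|n IH]; [apply: poly_0 | apply: poly_succ]. Qed.

Lemma poly_ext f g : (forall w s, f w s = g w s) -> poly f -> poly g.
Proof.
by move=> fg; rewrite (_ : f = g) //; apply: funext => w; apply: funext => s.
Qed.

Lemma poly_comp1 (F : seq S -> nat -> nat) f :
  poly (fun w s => F w (s 0)) -> poly f -> poly (fun w s => F w (f w s)).
Proof. by move=> pF pf; apply: (poly_let pF pf). Qed.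

Lemma poly_comp2 (F : seq S -> nat -> nat -> nat) f g :
  poly (fun w s => F w (s 0) (s 1)) -> poly f -> poly g ->
  poly (fun w s => F w (f w s) (g w s)).
Proof.
move=> pF pf pg.
(* [g] is bound first; [f] is then evaluated with its indices shifted past that value and bound in
   front of it. *)
exact: (poly_let (poly_let pF (poly_ren (fun i => i.+1) pf)) pg).
Qed.

Lemma poly_add f g : poly f -> poly g -> poly (fun w s => f w s + g w s).
Proof.
apply: (@poly_comp2 (fun w => addn)).
apply: (@poly_ext (fun w s => iteri (s 1) (fun _ x => x.+1) (s 0))).
  by move=> w s; elim: (s 1) => [|j /= ->]; rewrite ?addn0 ?addnS.
apply: poly_rec; [exact: poly_var | exact: poly_var | exact: poly_succ (poly_var _ _)|].
exists (fun m => m + m); first exact: pbound_add pbound_id pbound_id.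
move=> w s m hw hs j le_j; rewrite /iterate.
suff -> : iteri j (fun _ => succn) (s 0) = s 0 + j.
  by have := hs 0; have := hs 1; lia.
by elim: j {le_j} => [|j /= ->]; rewrite ?addn0 ?addnS.
Qed.

Lemma poly_pred f : poly f -> poly (fun w s => (f w s).-1).
Proof.
apply: (@poly_comp1 (fun w => predn)).
(* The step forgets the accumulator and returns the round index, whose last value is the
   predecessor. *)
apply: (@poly_ext (fun w s => iteri (s 0) (fun i _ => i) 0)).
  by move=> w s; case: (s 0).
apply: poly_rec; [exact: poly_var | exact: poly_const | exact: poly_var|].
exists id; first exact: pbound_id.
by move=> w s m hw hs [|j] le_j; rewrite /iterate //=; have := hs 0; lia.
Qed.

Lemma poly_sub f g : poly f -> poly g -> poly (fun w s => f w s - g w s).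
Proof.
apply: (@poly_comp2 (fun w => subn)).
apply: (@poly_ext (fun w s => iteri (s 1) (fun _ x => x.-1) (s 0))).
  by move=> w s; elim: (s 1) => [|j /= ->]; rewrite ?subn0 ?subnS.
apply: poly_rec; [exact: poly_var | exact: poly_var | exact: poly_pred (poly_var _ _)|].
exists id; first exact: pbound_id.
move=> w s m hw hs j le_j; rewrite /iterate.
suff -> : iteri j (fun _ => predn) (s 0) = s 0 - j by have := hs 0; lia.
by elim: j {le_j} => [|j /= ->]; rewrite ?subn0 ?subnS.
Qed.

Lemma poly_sum f (F : seq S -> (nat -> nat) -> nat -> nat) :
  poly f -> poly (fun w s => F w (fun i => s i.+1) (s 0)) ->
  poly (fun w s => \sum_(i < f w s) F w s i).
Proof.
move=> pf pF.
have sumE w s n : iteri n (fun i x => x + F w s i) 0 = \sum_(i < n) F w s i.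
  by elim: n => [|n /= ->]; rewrite ?big_ord0 ?big_ord_recr.
apply: (@poly_ext (fun w s => iteri (f w s) (fun i x => x + F w s i) 0)) => //.
apply: (@poly_rec _ (fun w s i x => x + F w s i)) => //.
- exact: poly_const.
- apply: poly_add (poly_var _ _) _.
  exact: (poly_ren (fun i => i.+1) pF).
have [gf pgf hf] := poly_bounded pf; have [gF pgF hF] := poly_bounded pF.
exists (fun m => gf m * gF (m + gf m)).
  by apply: pbound_mul => //; apply: pbound_comp => //; apply: pbound_add pbound_id _.
move=> w s m hw hs j le_j; rewrite /iterate sumE.
have le_fm := hf w s m hw hs.
apply: leq_trans (leq_mul (leq_trans le_j le_fm) (leqnn _)).
rewrite -[X in _ <= X * _]card_ord -sum_nat_const leq_sum // => i _.
apply: (hF w (scons i s)); first by lia.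
by case=> [|a] /=; [have := ltn_ord i | have := hs a]; lia.
Qed.

Lemma poly_mul f g : poly f -> poly g -> poly (fun w s => f w s * g w s).
Proof.
move=> pf pg; apply: (@poly_ext (fun w s => \sum_(i < f w s) g w s)).
  by move=> w s; rewrite sum_nat_const card_ord.
apply: (@poly_sum f (fun w s _ => g w s)) => //.
exact: (poly_ren (fun i => i.+1) pg).
Qed.

Lemma poly_eq0 f : poly f -> poly (fun w s => f w s == 0).
Proof.
move=> pf; apply: (@poly_ext (fun w s => 1 - f w s)).
  by move=> w s; case: (f w s).
exact: poly_sub (poly_const _) pf.
Qed.

Lemma poly_not b : poly b -> poly (fun w s => ~~ b w s).
Proof. by move/poly_eq0; apply: poly_ext => w s; case: (b w s). Qed.

Lemma poly_and b c : poly b -> poly c -> poly (fun w s => b w s && c w s).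
Proof. by move=> pb /(poly_mul pb); apply: poly_ext => w s; rewrite mulnb. Qed.

Lemma poly_or b c : poly b -> poly c -> poly (fun w s => b w s || c w s).
Proof.
move=> /poly_not pb /poly_not /(poly_and pb) /poly_not.
by apply: poly_ext => w s; rewrite negb_and !negbK.
Qed.

Lemma poly_imp b c : poly b -> poly c -> poly (fun w s => b w s ==> c w s).
Proof.
move=> /poly_not pb /(poly_or pb).
by apply: poly_ext => w s; rewrite implybE.
Qed.

Lemma poly_leq f g : poly f -> poly g -> poly (fun w s => f w s <= g w s).
Proof. by move=> pf pg; apply: poly_eq0 (poly_sub pf pg). Qed.

Lemma poly_eq f g : poly f -> poly g -> poly (fun w s => f w s == g w s).
Proof.
move=> pf pg; have := poly_and (poly_leq pf pg) (poly_leq pg pf).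
by apply: poly_ext => w s; rewrite eqn_leq.
Qed.

Lemma poly_eqb b c : poly b -> poly c -> poly (fun w s => b w s == c w s).
Proof.
move=> pb pc; apply: poly_ext (poly_eq pb pc) => w s.
by case: (b w s); case: (c w s).
Qed.

Lemma poly_all f (P : seq S -> (nat -> nat) -> nat -> bool) :
  poly f -> poly (fun w s => P w (fun i => s i.+1) (s 0)) ->
  poly (fun w s => all (P w s) (iota 0 (f w s))).
Proof.
move=> pf pP.
apply: (@poly_ext (fun w s => \sum_(i < f w s) ~~ P w s i == 0)).
  move=> w s; congr nat_of_bool; rewrite sum_nat_eq0.
  apply/forallP/allP => [h i|h i].
    by rewrite mem_iota /= add0n => lti; have := h (Ordinal lti) => /=; case: (P w s i).
  by rewrite h // mem_iota /=.
apply: poly_eq0; apply: (@poly_sum f (fun w s i => ~~ P w s i)) => //.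
exact: poly_not.
Qed.

Lemma poly_has f (P : seq S -> (nat -> nat) -> nat -> bool) :
  poly f -> poly (fun w s => P w (fun i => s i.+1) (s 0)) ->
  poly (fun w s => has (P w s) (iota 0 (f w s))).
Proof.
move=> pf pP; have := @poly_all f (fun w s i => ~~ P w s i) pf (poly_not pP).
by move/poly_not; apply: poly_ext => w s; rewrite -has_predC; congr nat_of_bool;
  apply: eq_has => i; rewrite /= negbK.
Qed.

Lemma poly_odd f : poly f -> poly (fun w s => odd (f w s)).
Proof.
apply: (@poly_comp1 (fun w n => odd n)).
have oddE n : iteri n (fun _ x => 1 - x) 0 = odd n.
  by elim: n => //= n ->; case: odd.
apply: (@poly_ext (fun w s => iteri (s 0) (fun _ x => 1 - x) 0)) => //.
apply: poly_rec; [exact: poly_var | exact: poly_const | |].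
  exact: poly_sub (poly_const _) (poly_var _ _).
exists (fun=> 1); first exact: pbound_const.
by move=> w s m hw hs j le_j; rewrite /iterate oddE; case: odd.
Qed.

Lemma poly_half f : poly f -> poly (fun w s => (f w s)./2).
Proof.
(* Half of n, rounded down, counts the odd numbers below n. *)
move=> pf; apply: (@poly_ext (fun w s => \sum_(i < f w s) odd i)).
  move=> w s; elim: (f w s) => [|n IH]; first by rewrite big_ord0.
  by rewrite big_ord_recr /= IH; lia.
apply: (@poly_sum f (fun w s i => nat_of_bool (odd i))) => //.
exact: poly_odd (poly_var _ _).
Qed.

End Arithmetic.

(* Numbers are given by finitely many base 2 digits that may exceed 1;
   [carry x k] is the carry into position [k] when they are normalized. *)
Definition value (x : nat -> nat) (L : nat) : nat := \sum_(k < L) x k * 2 ^ k.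

Definition carry (x : nat -> nat) (L : nat) : nat :=
  iteri L (fun k c => (c + x k)./2) 0.

Definition digit (x : nat -> nat) (k : nat) : bool := odd (carry x k + x k).

(* Adding the complement of [y] to [x] overflows exactly when [y < x]. *)
Definition less (y x : nat -> nat) (L : nat) : bool :=
  0 < carry (fun k => digit x k + ~~ digit y k) L.

Definition same (x y : nat -> nat) (L : nat) : bool :=
  ~~ less x y L && ~~ less y x L.

(** Coefficients of the product of two digit polynomials, not normalized; the Boolean factors keep
    both indices below [W]. *)
Definition conv (W : nat) (x y : nat -> nat) (k : nat) : nat :=
  \sum_(i < W) (i <= k) * (k - i < W) * (x i * y (k - i)).

Lemma value_carry x L : value x L = value (digit x) L + carry x L * 2 ^ L.
Proof.
elim: L => [|L IH]; first by rewrite /value !big_ord0.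
rewrite /value !big_ord_recr /= -/(value x L) -/(value (digit x) L) IH.
rewrite expnS mulnA -!addnA -!mulnDl; congr (_ + _ * _).
by rewrite /digit muln2 odd_double_half.
Qed.

Lemma value_bool_lt (x : nat -> bool) L : value x L < 2 ^ L.
Proof.
elim: L => [|L IH]; first by rewrite /value big_ord0.
move: IH; rewrite /value big_ord_recr /= expnS.
by case: (x L); rewrite ?mul1n ?mul0n; lia.
Qed.

Lemma less_value x y L : value x L < 2 ^ L -> value y L < 2 ^ L ->
  less y x L = (value y L < value x L).
Proof.
move=> hx hy; pose z k := digit x k + ~~ digit y k.
(* Nothing is carried out of a number below 2^L, so normalization preserves its value. *)
have dig u : value u L < 2 ^ L -> value (digit u) L = value u L.
  by rewrite (value_carry u); case: (carry u L) => [|c]; rewrite ?addn0 // mulSn; lia.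
have zE : value z L + value y L = value x L + (2 ^ L).-1.
  rewrite -(dig x) // -(dig y) // /z /value.
  elim: L {hx hy dig} => [|L IH]; first by rewrite !big_ord0.
  rewrite !big_ord_recr /= expnS; move: IH.
  have : 0 < 2 ^ L by rewrite expn_gt0.
  by case: (digit x L); case: (digit y L); rewrite /= ?mul0n ?mul1n; lia.
have := value_carry z L; have := value_bool_lt (digit z) L; rewrite /less -/z.
have p_gt0 : 0 < 2 ^ L by rewrite expn_gt0.
move: (2 ^ L) p_gt0 hx hy zE => p p_gt0 hx hy zE.
by case: (carry z L) => [|c]; rewrite ?mul0n ?mulSn => ? ?; apply/idP/idP; lia.
Qed.

Lemma same_value x y L : value x L < 2 ^ L -> value y L < 2 ^ L ->
  same x y L = (value x L == value y L).
Proof. by move=> hx hy; rewrite /same !less_value //; lia. Qed.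

(** Digit products sit at positions i + j < 2W, so [L] positions truncate nothing. *)
Lemma value_conv W x y L : 2 * W <= L ->
  value (conv W x y) L = value x W * value y W.
Proof.
move=> leL; rewrite /value big_distrlr /=.
under eq_bigr do rewrite big_distrl /=.
rewrite exchange_big /=; apply: eq_bigr => i _.
rewrite -(big_mkord xpredT (fun k => (i <= k) * (k - i < W) * (x i * y (k - i)) * 2 ^ k)).
have le_iL : i <= L by have := ltn_ord i; lia.
rewrite (big_cat_nat (leq0n i) le_iL) //= big_nat big1 ?add0n; last first.
  by move=> k /andP[_ ltk]; rewrite leqNgt ltk.
rewrite -{1}(add0n i) big_addn.
have le_WL : W <= L - i by have := ltn_ord i; lia.
rewrite (big_cat_nat (leq0n W) le_WL) //= [X in _ + X]big_nat [X in _ + X]big1 ?addn0; last first.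
  by move=> k /andP[leW _]; rewrite addnK ltnNge leW muln0.
rewrite big_mkord; apply: eq_bigr => j _.
by rewrite addnK leq_addl ltn_ord !mul1n expnD; lia.
Qed.

(** * Comparison and multiplication of long numbers in polynomial time *)

Section PolyNumbers.
Variable S : finType.
Implicit Types f g : seq S -> (nat -> nat) -> nat.
Implicit Types X Y : seq S -> (nat -> nat) -> nat -> nat.

Lemma poly_carry X f : poly (fun w s => X w (fun i => s i.+1) (s 0)) ->
  poly f -> poly (fun w s => carry (X w s) (f w s)).
Proof.
move=> pX pf.
apply: (@poly_rec _ (fun w s k c => (c + X w s k)./2)) => //.
- exact: poly_const.
- apply: poly_half; apply: poly_add (poly_var _ _) _.
  exact: (poly_ren (fun i => i.+1) pX).
have [gf pgf hf] := poly_bounded pf; have [gX pgX hX] := poly_bounded pX.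
(* If c and x are at most M, so is half of c + x: a bound on the digits also bounds the carries. *)
exists (fun m => gX (m + gf m)).
  by apply: pbound_comp => //; apply: pbound_add pbound_id _.
move=> w s m hw hs; have le_fm := hf w s m hw hs; rewrite /iterate.
elim=> [|j IH] lt_j //=; have {}IH := IH (ltnW lt_j).
have : X w s j <= gX (m + gf m); last by lia.
apply: (hX w (scons j s)); first by lia.
by case=> [|a] /=; [|have := hs a]; lia.
Qed.

Lemma poly_digit X f : poly (fun w s => X w (fun i => s i.+1) (s 0)) ->
  poly f -> poly (fun w s => digit (X w s) (f w s)).
Proof.
move=> pX pf; apply: poly_odd; apply: poly_add (poly_carry pX pf) _.
exact: poly_let pX pf.
Qed.

Lemma poly_less X Y f : poly (fun w s => X w (fun i => s i.+1) (s 0)) ->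
  poly (fun w s => Y w (fun i => s i.+1) (s 0)) ->
  poly f -> poly (fun w s => less (X w s) (Y w s) (f w s)).
Proof.
move=> pX pY pf; apply: poly_leq (poly_const _ _) _.
apply: (@poly_carry (fun w s k => digit (Y w s) k + ~~ digit (X w s) k)) => //.
(* Index 0 is the inner digit position and index 1 the outer one, which [X] and [Y] must skip. *)
pose xi i := if i is j.+1 then j.+2 else 0.
apply: poly_add; last apply: poly_not.
- apply: (@poly_digit (fun w s => Y w (fun i => s i.+1))) (poly_var _ _).
  exact: (poly_ren xi pY).
- apply: (@poly_digit (fun w s => X w (fun i => s i.+1))) (poly_var _ _).
  exact: (poly_ren xi pX).
Qed.

Lemma poly_same X Y f : poly (fun w s => X w (fun i => s i.+1) (s 0)) ->
  poly (fun w s => Y w (fun i => s i.+1) (s 0)) ->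
  poly f -> poly (fun w s => same (X w s) (Y w s) (f w s)).
Proof.
by move=> pX pY pf; apply: poly_and; apply: poly_not; apply: poly_less.
Qed.

Lemma poly_conv X Y f g : poly (fun w s => X w (fun i => s i.+1) (s 0)) ->
  poly (fun w s => Y w (fun i => s i.+1) (s 0)) ->
  poly f -> poly g -> poly (fun w s => conv (f w s) (X w s) (Y w s) (g w s)).
Proof.
move=> pX pY pf pg; pose sh i := i.+1.
have pf' := poly_ren sh pf; have pg' := poly_ren sh pg.
apply: (@poly_sum _ f (fun w s i => (i <= g w s) * (g w s - i < f w s) *
                                  (X w s i * Y w s (g w s - i)))) => //.
have pi := poly_var S 0.
apply: poly_mul; first (apply: poly_mul; first exact: poly_leq).
  apply: poly_leq => //; apply: poly_succ; exact: poly_sub.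
apply: poly_mul => //.
pose xi i := if i is j.+1 then j.+2 else 0.
exact: (poly_let (poly_ren xi pY) (poly_sub pg' pi)).
Qed.

End PolyNumbers.

(** * Sparse solutions of 0/1 systems *)

Section SparseSolutions.
Import Order.TTheory GRing.Theory Num.Theory.
Local Open Scope ring_scope.
Variables (R : realFieldType) (T : finType) (m : nat).
Variables (a : 'I_m -> pred T) (r0 : 'I_m) (rhs : 'I_m -> rat) (o : pred T).
Hypothesis a_r0 : forall w, a r0 w.

Definition feasible (p : T -> R) :=
  (forall w, 0 <= p w) /\ forall r, \sum_w p w *+ a r w = ratr (rhs r).

Definition support (p : T -> R) : {set T} := [set w | p w != 0].

(** Stored transposed, with support points as rows, so that independence is [row_free]. *)
Definition columns (p : T -> R) : 'M[int]_(#|support p|, m) :=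
  \matrix_(i, r) (a r (enum_val i) : nat)%:Z.

Definition independent (p : T -> R) : bool :=
  row_free (map_mx intr (columns p) : 'M[R]_(_, _)).

(** A linear relation among the columns, extended by 0 off the support; either it or its negative
    does not lower the objective. *)
Lemma direction p : ~~ independent p -> exists d : T -> R,
  [/\ exists w, d w != 0, forall w, d w != 0 -> w \in support p,
      forall r, \sum_w d w *+ a r w = 0 & 0 <= \sum_w d w *+ o w].
Proof.
rewrite /independent -kermx_eq0 => /rowV0Pn[v /sub_kermxP vM v_neq0].
pose d w := \sum_i v 0 i *+ (enum_val i == w).
have dE (P : pred T) : \sum_w d w *+ P w = \sum_i v 0 i *+ P (enum_val i).
  under eq_bigr do rewrite /d -sumrMnl; rewrite exchange_big /=.
  apply: eq_bigr => i _; rewrite (bigD1 (enum_val i)) //= eqxx mulr1n big1 ?addr0 //.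
  by move=> w /negPf neq_w; rewrite eq_sym neq_w mul0rn.
have d_val i : d (enum_val i) = v 0 i.
  rewrite /d (bigD1 i) //= eqxx mulr1n big1 ?addr0 // => j neq_ji.
  by rewrite (inj_eq enum_val_inj) (negPf neq_ji).
have d_neq0 : exists w, d w != 0.
  by have [i vi] := rV0Pn _ v_neq0; exists (enum_val i); rewrite d_val.
have d_supp w : d w != 0 -> w \in support p.
  apply: contraR => w_out; rewrite /d big1 // => i _.
  by case: eqP => // iw; case/negP: w_out; rewrite -iw; apply: enum_valP.
have d_ker r : \sum_w d w *+ a r w = 0.
  rewrite dE; transitivity ((v *m map_mx intr (columns p)) 0 r); last by rewrite vM mxE.
  by rewrite mxE; apply: eq_bigr => i _; rewrite !mxE -mulr_natr.
have [d_ge0|d_lt0] := leP 0 (\sum_w d w *+ o w); first by exists d.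
exists (fun w => - d w); split.
- by have [w dw] := d_neq0; exists w; rewrite oppr_eq0.
- by move=> w; rewrite oppr_eq0; apply: d_supp.
- by move=> r; under eq_bigr do rewrite mulNrn; rewrite sumrN d_ker oppr0.
- by under eq_bigr do rewrite mulNrn; rewrite sumrN oppr_ge0 ltW.
Qed.

(* Move along a direction given by [direction] until a coordinate vanishes. *)
Lemma shrink_support p : feasible p -> ~~ independent p -> exists p',
  [/\ feasible p', \sum_w p w *+ o w <= \sum_w p' w *+ o w &
      support p' \proper support p].
Proof.
case=> p_ge0 p_eq /direction[d [[w0 dw0] d_supp d_ker d_obj]].
(* The all-ones row [r0] makes the entries of [d] sum to 0, so a nonzero [d] has a negative
   entry. *)
have [w1 dw1] : exists w, d w < 0.
  case: (boolP [exists w, d w < 0]) => [/existsP//|/existsPn d_nlt].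
  have d_ge0 w : 0 <= d w by rewrite leNgt.
  have /psumr_eq0P d0 : \sum_w d w = 0.
    by rewrite -[RHS](d_ker r0); apply: eq_bigr => w _; rewrite a_r0.
  by rewrite d0 ?eqxx in dw0.
(* The ratio test of the simplex method: [w2] is a coordinate that reaches 0 first, at step length
   t. *)
have [w2 dw2 w2_min] := @arg_minP _ _ _ w1 (fun w => d w < 0) (fun w => p w / - d w) dw1.
pose t := p w2 / - d w2.
have t_ge0 : 0 <= t by rewrite divr_ge0 // oppr_ge0 ltW.
exists (fun w => p w + t * d w); split; first split.
- move=> w; have [d_ge0|d_lt0] := leP 0 (d w); first by apply: addr_ge0 (p_ge0 w) (mulr_ge0 t_ge0 d_ge0).
  by have := w2_min w d_lt0; rewrite -/t ler_pdivlMr ?oppr_gt0 // mulrN lerNl -subr_ge0 opprK addrC.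
- move=> r; under eq_bigr do rewrite mulrnDl -mulrnAr.
  by rewrite big_split /= -mulr_sumr d_ker mulr0 addr0.
- under [X in _ <= X]eq_bigr do rewrite mulrnDl -mulrnAr.
  by rewrite big_split /= -mulr_sumr lerDl mulr_ge0.
apply/properP; split.
  apply/subsetP => w; rewrite inE; apply: contraR => w_out.
  have /eqP-> : d w == 0 by apply: contraR w_out => /d_supp.
  by move: w_out; rewrite inE negbK mulr0 addr0.
exists w2; first by apply: d_supp; rewrite lt_eqF.
rewrite inE negbK /t invrN mulrN mulNr divfK ?subrr //.
by rewrite lt_eqF.
Qed.

Lemma independent_solution p : feasible p -> exists p',
  [/\ feasible p', \sum_w p w *+ o w <= \sum_w p' w *+ o w & independent p'].
Proof.
move: {2}#|support p| (leqnn #|support p|) => n.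
elim: n p => [|n IH] p le_n p_feas.
  have [p_ind|p_dep] := boolP (independent p); first by exists p.
  have [p' [_ _ /proper_card]] := shrink_support p_feas p_dep.
  by rewrite ltnNge (leq_trans le_n).
have [p_ind|p_dep] := boolP (independent p); first by exists p.
have [p1 [p1_feas le_p1 /proper_card lt_p1]] := shrink_support p_feas p_dep.
have [|p2 [p2_feas le_p2 p2_ind]] := IH p1 _ p1_feas.
  by rewrite -ltnS (leq_trans lt_p1).
by exists p2; split=> //; apply: le_trans le_p2.
Qed.

(** Leibniz expansion: n! terms of absolute value at most 1. *)
Lemma det_bool_le n (A : 'M[int]_n) : (forall i j, `|A i j| <= 1) ->
  (`|\det A| <= n`!)%N.
Proof.
move=> A_le1; rewrite -lez_nat abszE.
apply: le_trans (ler_norm_sum _ _ _) _.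
rewrite -(card_Sn n) -sum1_card.
rewrite -[leRHS]natz natr_sum.
rewrite [leRHS](eq_bigl xpredT) => [|s]; last by rewrite inE.
apply: ler_sum => s _; rewrite normrM normrX normrN1 expr1n mul1r normr_prod.
by apply: prodr_ile1 => i _; rewrite normr_ge0 A_le1.
Qed.

Lemma sparse_solution (b : R) p : feasible p -> b < \sum_w p w *+ o w ->
  exists (D : nat) (c : T -> nat),
  [/\ (0 < D <= m`! * \prod_r `|denq (rhs r)|)%N,
      (#|[set w | c w != 0%N]| <= m)%N,
      forall r, (\sum_w c w * a r w)%N%:R = ratr (rhs r) * D%:R :> R &
      b * D%:R < (\sum_w c w * o w)%N%:R].
Proof.
move=> /independent_solution[p' [p'_feas le_obj p_ind]] lt_b.
have {le_obj p lt_b}lt_b := lt_le_trans lt_b le_obj.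
move: p' p'_feas p_ind lt_b => p [p_ge0 p_eq] p_ind lt_b.
pose M : 'M[R]_(_, _) := map_mx intr (columns p).
set s := #|support p| in M.
have le_sm : (s <= m)%N by rewrite -(eqP (p_ind : row_free M)) rank_leq_col.
have Mfull : row_full M^T by rewrite /row_full mxrank_tr; apply: p_ind.
(* [f] selects as many independent constraints as there are support points; they determine [p] on
   its support. *)
pose f := fullrankfun Mfull.
pose Gz : 'M[int]_s := rowsub f (columns p)^T.
pose G : 'M[R]_s := map_mx intr Gz.
have GE : G = rowsub f M^T by apply/matrixP => i j; rewrite !mxE.
have G_unit : G \in unitmx by rewrite GE; apply: fullrowsub_unit.
have detG : \det G = (\det Gz)%:~R by rewrite det_map_mx.
have detGz_neq0 : \det Gz != 0.
  by move: G_unit; rewrite unitmxE unitfE detG intr_eq0.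
pose Den := (\prod_r `|denq (rhs r)|)%N.
(* The determinant clears the inverse of [G], and [Den] the right-hand sides. *)
pose D := (`|\det Gz| * Den)%N.
have Den_gt0 : (0 < Den)%N by apply: prodn_gt0 => r; rewrite absz_gt0 denq_eq0.
have D_gt0 : (0 < D)%N by rewrite muln_gt0 absz_gt0 detGz_neq0.
have DenE r : exists z : int, ratr (rhs r) * Den%:R = z%:~R :> R.
  exists (numq (rhs r) * (\prod_(r' | r' != r) `|denq (rhs r')|)%N).
  rewrite /Den (bigD1 r) //= natrM mulrA intrM; congr (_ * _).
  rewrite /ratr -[`|denq _|%N%:R]/((`|denq (rhs r)|%N : int)%:~R) absz_denq divfK //.
  by rewrite intr_eq0 denq_eq0.
have [z zE] := fin_all_exists DenE.
have p_int w : exists n : nat, p w * D%:R = n%:R.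
  have [pw0|pw_neq0] := eqVneq (p w) 0; first by exists 0%N; rewrite pw0 mul0r.
  have w_in : w \in support p by rewrite inE.
  pose i := enum_rank_in w_in w.
  pose x : 'cV[R]_s := \col_j p (enum_val j).
  have xi : x i 0 = p w by rewrite mxE enum_rankK_in.
  have Gx j : (G *m x) j 0 = ratr (rhs (f j)).
    rewrite -p_eq mxE [RHS](bigID (fun w => w \in support p)) /= [X in _ = _ + X]big1 ?addr0; last first.
      by move=> w'; rewrite inE negbK => /eqP->; rewrite mul0rn.
    rewrite [RHS](reindex_onto (@enum_val _ (mem (support p))) (enum_rank_in w_in)) /=.
      apply: eq_big => [k|k _]; first by rewrite enum_valP enum_valK_in eqxx.
      by rewrite !mxE mulrC mulr_natr.
    by move=> w' w'_in; rewrite enum_rankK_in.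
  pose y : int := \sum_j (\adj Gz) i j * z (f j).
  (* The determinant may be negative; since [p w] is not, absolute values repair the sign. *)
  exists `|y|%N; suff <- : `|p w * (\det Gz)%:~R * Den%:R| = `|y|%N%:R.
    rewrite !normrM (ger0_norm (p_ge0 w)) normr_nat /D natrM mulrA; congr (_ * _ * _).
    by rewrite -intr_norm -abszE.
  have -> : p w * (\det Gz)%:~R * Den%:R = y%:~R.
    rewrite -xi -detG.
    have -> : x i 0 * \det G = (\adj G *m (G *m x)) i 0.
      by rewrite mulmxA mul_adj_mx mul_scalar_mx [RHS]mxE mulrC.
    rewrite mxE mulr_suml rmorph_sum; apply: eq_bigr => j _.
    by rewrite Gx -mulrA zE rmorphM /= -map_mx_adj mxE.
  by rewrite -intr_norm -abszE.
have [c cE] := fin_all_exists p_int.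
have D_neq0 : D%:R != 0 :> R by rewrite pnatr_eq0 -lt0n.
have sumE (P : pred T) : (\sum_w c w * P w)%N%:R = (\sum_w p w *+ P w) * D%:R :> R.
  rewrite natr_sum mulr_suml; apply: eq_bigr => w _.
  by rewrite natrM -cE mulr_natr mulrnAl.
exists D, c; split.
- rewrite D_gt0 leq_mul2r; apply/orP; right.
  apply: leq_trans (_ : s`! <= _)%N; last by rewrite leq_fact.
  by apply: det_bool_le => i j; rewrite !mxE; case: (a _ _).
- apply: leq_trans le_sm; apply/subset_leq_card/subsetP => w; rewrite !inE.
  apply: contraNneq => pw0; rewrite -(pnatr_eq0 R) -cE pw0 mul0r //.
- by move=> r; rewrite sumE p_eq.
- by rewrite sumE ltr_pM2r // ltr0n.
Qed.

End SparseSolutions.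

(** * The verifier *)

Notation letter := (sym + bool)%type.

Definition is_input (a : option letter) : bool := if a is Some (inl _) then true else false.
Definition is_sep (a : option letter) : bool := if a is Some (inl None) then true else false.
Definition is_one (a : option letter) : bool := if a is Some (inl (Some true)) then true else false.
Definition is_cert (a : option letter) : bool := if a is Some (inr true) then true else false.

Section Verifier.
Variable z : seq letter.

Definition input_size := \sum_(i < size z) is_input (onth z i).
Definition seps (i : nat) := \sum_(j < i) is_sep (onth z j).
Definition fields := seps (size z).

(* A position belongs to one of the first [m] fields (separator included) when
   fewer than [m] separators precede it. *)
Definition start (m : nat) := \sum_(i < size z) (seps i < m).
(** The predecessor drops the separator. *)
Definition field_size (m : nat) := (start m.+1 - start m).-1.
Definition field_bit (m k : nat) := is_one (onth z (start m + k)).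

(** This is [fields] divided by 3, rounded down, in a form covered by [poly_sum]. *)
Definition entries := \sum_(i < fields) (3 * i.+1 <= fields).
Definition attrs := field_size 0.

(* Entry 0 is the target with its threshold, the others form the family. *)
Definition member (e k : nat) := field_bit (3 * e) k.
(** Position 0 of the numerator field is the sign; hence the shifts by one in [num_size] and
    [num]. *)
Definition negative (e : nat) := field_bit (3 * e).+1 0.
Definition num_size (e : nat) := (field_size (3 * e).+1).-1.
Definition num (e k : nat) := (k < num_size e) && field_bit (3 * e).+1 k.+1.
Definition den_size (e : nat) := field_size (3 * e).+2.
Definition den (e k : nat) := (k < den_size e) && field_bit (3 * e).+2 k.

Definition width := input_size.+1 * input_size.+1.

(* The certificate is a 4 x width x width array: attribute vectors, their
   weights, and two Bezout coefficients for each entry. *)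
Definition cert (t a j : nat) :=
  is_cert (onth z (input_size + ((t * width + a) * width + j))).

(** The weights are added position by position without carrying; the large digits are normalized
    only when compared. *)
Definition total (k : nat) := \sum_(a < width) cert 1 a k.
Definition contains (e a : nat) :=
  all (fun k => member e k ==> cert 0 a k) (iota 0 attrs).
Definition covered (e k : nat) := \sum_(a < width) contains e a * cert 1 a k.

(** The first equation says that the input ends with a separator, leaving no unterminated field. *)
Definition check_layout :=
  [&& start fields == input_size, fields == 3 * entries, 0 < entries & 0 < attrs].

(** Canonicity of the fields: a sign is present, the top digit (which comes last) is 1, zero is not
    negative, and coprimality is tested without subtraction, [(k == 0)] adding the 1 of the Bezout
    identity at digit 0. *)
Definition check_entry (e : nat) :=
  [&& field_size (3 * e) == attrs, 0 < field_size (3 * e).+1,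
      (0 < num_size e) ==> num e (num_size e).-1,
      negative e ==> (0 < num_size e),
      (0 < den_size e) && den e (den_size e).-1 &
      same (conv width (fun k => cert 3 e k) (fun k => den e k))
           (fun k => conv width (fun k => cert 2 e k) (fun k => num e k) k + (k == 0))
           (4 * width)].

Definition check_distinct :=
  all (fun e => (0 < e) ==> all (fun e' => (e < e') ==>
    has (fun k => member e k != member e' k) (iota 0 attrs))
    (iota 0 entries)) (iota 0 entries).

(** A member may have exponentially many subsets; closure under deleting a single attribute implies
    closure under all of them. *)
Definition check_antimonotonic :=
  all (fun e => (0 < e) ==> all (fun k => member e k ==>
    has (fun e' => (0 < e') &&
      all (fun l => member e' l == (member e l && (l != k))) (iota 0 attrs))
    (iota 0 entries)) (iota 0 attrs)) (iota 0 entries).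

(** Cross-multiplied form of covered / total = num / den. Only the absolute value of the numerator
    enters, so the sign is tested apart. *)
Definition check_frequency (e : nat) := (0 < e) ==> ~~ negative e &&
  same (conv width (covered e) (fun k => den e k))
       (conv width total (fun k => num e k)) (4 * width).

(** The first test makes the total weight positive, so that it can be divided by; a negative
    threshold is exceeded by every frequency. *)
Definition check_bound :=
  has (fun k => 0 < total k) (iota 0 width) && (negative 0 ||
  less (conv width total (fun k => num 0 k))
       (conv width (covered 0) (fun k => den 0 k)) (4 * width)).

Definition verify :=
  [&& check_layout, all check_entry (iota 0 entries), check_distinct,
      check_antimonotonic, all check_frequency (iota 0 entries) & check_bound].

End Verifier.

(** * Syntax-directed proof that the verifier is polynomial *)

Ltac poly_step :=
  lazymatch goal with
  | |- poly (fun w s => s _) => exact: poly_var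
  | |- poly (fun w s => S (@?f w s)) => refine (poly_succ (f := f) _)
  | |- poly (fun w s => (@?f w s) + (@?g w s)) => refine (poly_add (f := f) (g := g) _ _)
  | |- poly (fun w s => (@?f w s) * (@?g w s)) => refine (poly_mul (f := f) (g := g) _ _)
  | |- poly (fun w s => (@?f w s) - (@?g w s)) => refine (poly_sub (f := f) (g := g) _ _)
  | |- poly (fun w s => (@?f w s).-1) => refine (poly_pred (f := f) _)
  | |- poly (fun w s => size w) => exact: poly_size
  | |- poly (fun w s => nat_of_bool (?P (onth w (@?f w s)))) => refine (poly_sym P (f := f) _)
  | |- poly (fun w s => nat_of_bool (~~ (@?f w s))) => refine (poly_not (b := f) _)
  | |- poly (fun w s => nat_of_bool ((@?f w s) && (@?g w s))) =>
      refine (poly_and (b := f) (c := g) _ _)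
  | |- poly (fun w s => nat_of_bool ((@?f w s) || (@?g w s))) =>
      refine (poly_or (b := f) (c := g) _ _)
  | |- poly (fun w s => nat_of_bool ((@?f w s) ==> (@?g w s))) =>
      refine (poly_imp (b := f) (c := g) _ _)
  | |- poly (fun w s => nat_of_bool ((@?f w s) <= (@?g w s))) =>
      refine (poly_leq (f := f) (g := g) _ _)
  | |- poly (fun w s => nat_of_bool (@eq_op Datatypes_nat__canonical__eqtype_Equality (@?f w s) (@?g w s))) =>
      refine (poly_eq (f := f) (g := g) _ _)
  | |- poly (fun w s => nat_of_bool (@eq_op Datatypes_bool__canonical__eqtype_Equality (@?f w s) (@?g w s))) =>
      refine (poly_eqb (b := f) (c := g) _ _)
  | |- poly (fun w s => nat_of_bool (all (@?P w s) (iota 0 (@?f w s)))) =>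
      refine (poly_all (P := P) (f := f) _ _)
  | |- poly (fun w s => nat_of_bool (has (@?P w s) (iota 0 (@?f w s)))) =>
      refine (poly_has (P := P) (f := f) _ _)
  | |- poly (fun w s => conv (@?f w s) (@?X w s) (@?Y w s) (@?g w s)) =>
      refine (poly_conv (X := X) (Y := Y) (f := f) (g := g) _ _ _ _)
  | |- poly (fun w s => nat_of_bool (same (@?X w s) (@?Y w s) (@?f w s))) =>
      refine (poly_same (X := X) (Y := Y) (f := f) _ _ _)
  | |- poly (fun w s => nat_of_bool (less (@?X w s) (@?Y w s) (@?f w s))) =>
      refine (poly_less (X := X) (Y := Y) (f := f) _ _ _)
  | |- poly (fun w s => _) => exact: poly_const
  end; cbv beta.

Ltac poly_tac := repeat first [eassumption | poly_step].

Section PolyVerifier.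
Implicit Types f g h : seq letter -> (nat -> nat) -> nat.

Lemma poly_input_size : poly (fun w s => input_size w).
Proof.
apply: (@poly_sum _ _ (fun w s i => nat_of_bool (is_input (onth w i)))); poly_tac.
Qed.

Lemma poly_seps f : poly f -> poly (fun w s => seps w (f w s)).
Proof.
move=> pf; apply: (@poly_sum _ _ (fun w s i => nat_of_bool (is_sep (onth w i)))) => //.
poly_tac.
Qed.

Lemma poly_fields : poly (fun w s => fields w).
Proof. by apply: poly_seps; apply: poly_size. Qed.

Lemma poly_start f : poly f -> poly (fun w s => start w (f w s)).
Proof.
move=> pf; apply: (@poly_sum _ _ (fun w s i => nat_of_bool (seps w i < f w s))).
  exact: poly_size.
apply: poly_leq; first by apply: poly_succ; apply: poly_seps; apply: poly_var.
exact: (poly_ren (fun i => i.+1) pf).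
Qed.

Lemma poly_field_size f : poly f -> poly (fun w s => field_size w (f w s)).
Proof.
by move=> pf; apply: poly_pred; apply: poly_sub; apply: poly_start => //; apply: poly_succ.
Qed.

Lemma poly_field_bit f g : poly f -> poly g ->
  poly (fun w s => field_bit w (f w s) (g w s)).
Proof.
by move=> pf pg; apply: poly_sym; apply: poly_add => //; apply: poly_start.
Qed.

Lemma poly_entries : poly (fun w s => entries w).
Proof.
apply: (@poly_sum _ _ (fun w s i => nat_of_bool (3 * i.+1 <= fields w))).
  exact: poly_fields.
by poly_tac; apply: poly_fields.
Qed.

Lemma poly_width : poly (fun w s => width w).
Proof. by apply: poly_mul; apply: poly_succ; apply: poly_input_size. Qed.

Lemma poly_cert f g h : poly f -> poly g -> poly h ->
  poly (fun w s => cert w (f w s) (g w s) (h w s)).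
Proof.
move=> pf pg ph; apply: poly_sym; apply: poly_add; first exact: poly_input_size.
by have pW := poly_width; poly_tac.
Qed.

Lemma poly_attrs : poly (fun w s => attrs w).
Proof. by apply: poly_field_size; apply: poly_const. Qed.

Lemma poly_member f g : poly f -> poly g -> poly (fun w s => member w (f w s) (g w s)).
Proof. by move=> pf pg; apply: poly_field_bit => //; poly_tac. Qed.

Lemma poly_negative f : poly f -> poly (fun w s => negative w (f w s)).
Proof. by move=> pf; apply: poly_field_bit; poly_tac. Qed.

Lemma poly_num_size f : poly f -> poly (fun w s => num_size w (f w s)).
Proof. by move=> pf; apply: poly_pred; apply: poly_field_size; poly_tac. Qed.

Lemma poly_den_size f : poly f -> poly (fun w s => den_size w (f w s)).
Proof. by move=> pf; apply: poly_field_size; poly_tac. Qed.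

Lemma poly_num f g : poly f -> poly g -> poly (fun w s => num w (f w s) (g w s)).
Proof.
move=> pf pg; apply: poly_and; last by apply: poly_field_bit; poly_tac.
by apply: poly_leq; [apply: poly_succ | apply: poly_num_size].
Qed.

Lemma poly_den f g : poly f -> poly g -> poly (fun w s => den w (f w s) (g w s)).
Proof.
move=> pf pg; apply: poly_and; last by apply: poly_field_bit; poly_tac.
by apply: poly_leq; [apply: poly_succ | apply: poly_den_size].
Qed.

Lemma poly_total f : poly f -> poly (fun w s => total w (f w s)).
Proof.
move=> pf; apply: (@poly_sum _ _ (fun w s a => nat_of_bool (cert w 1 a (f w s)))).
  exact: poly_width.
apply: poly_cert; [exact: poly_const | exact: poly_var|].
exact: (poly_ren (fun i => i.+1) pf).
Qed.

Lemma poly_contains f g : poly f -> poly g ->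
  poly (fun w s => contains w (f w s) (g w s)).
Proof.
move=> pf pg; have pf' := poly_ren (fun i => i.+1) pf.
have pg' := poly_ren (fun i => i.+1) pg.
apply: (@poly_all _ _ (fun w s k => member w (f w s) k ==> cert w 0 (g w s) k)).
  exact: poly_attrs.
apply: poly_imp; first by apply: poly_member => //; apply: poly_var.
by apply: poly_cert => //; [apply: poly_const | apply: poly_var].
Qed.

Lemma poly_covered f g : poly f -> poly g ->
  poly (fun w s => covered w (f w s) (g w s)).
Proof.
move=> pf pg; have pf' := poly_ren (fun i => i.+1) pf.
have pg' := poly_ren (fun i => i.+1) pg.
apply: (@poly_sum _ _ (fun w s a => contains w (f w s) a * cert w 1 a (g w s))).
  exact: poly_width.
apply: poly_mul; first by apply: poly_contains => //; apply: poly_var.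
by apply: poly_cert => //; [apply: poly_const | apply: poly_var].
Qed.

Ltac poly_leaf :=
  lazymatch goal with
  | |- poly (fun w s => input_size w) => exact: poly_input_size
  | |- poly (fun w s => fields w) => exact: poly_fields
  | |- poly (fun w s => entries w) => exact: poly_entries
  | |- poly (fun w s => attrs w) => exact: poly_attrs
  | |- poly (fun w s => width w) => exact: poly_width
  | |- poly (fun w s => start w (@?f w s)) => refine (poly_start (f := f) _)
  | |- poly (fun w s => field_size w (@?f w s)) => refine (poly_field_size (f := f) _)
  | |- poly (fun w s => num_size w (@?f w s)) => refine (poly_num_size (f := f) _)
  | |- poly (fun w s => den_size w (@?f w s)) => refine (poly_den_size (f := f) _)
  | |- poly (fun w s => total w (@?f w s)) => refine (poly_total (f := f) _)
  | |- poly (fun w s => nat_of_bool (negative w (@?f w s))) => refine (poly_negative (f := f) _)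
  | |- poly (fun w s => nat_of_bool (member w (@?f w s) (@?g w s))) =>
      refine (poly_member (f := f) (g := g) _ _)
  | |- poly (fun w s => nat_of_bool (num w (@?f w s) (@?g w s))) =>
      refine (poly_num (f := f) (g := g) _ _)
  | |- poly (fun w s => nat_of_bool (den w (@?f w s) (@?g w s))) =>
      refine (poly_den (f := f) (g := g) _ _)
  | |- poly (fun w s => covered w (@?f w s) (@?g w s)) =>
      refine (poly_covered (f := f) (g := g) _ _)
  | |- poly (fun w s => nat_of_bool (cert w (@?f w s) (@?g w s) (@?h w s))) =>
      refine (poly_cert (f := f) (g := g) (h := h) _ _ _)
  | |- _ => poly_step
  end; cbv beta.

Lemma poly_verify : poly (fun w s => verify w).
Proof.
rewrite /verify /check_layout /check_entry /check_distinct /check_antimonotonic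
  /check_frequency /check_bound.
repeat poly_leaf.
Qed.

End PolyVerifier.

Lemma verify_in_P : in_P (fun w : seq letter => verify w).
Proof. exact: poly_in_P poly_verify. Qed.

(** * Encodings *)

Fixpoint nat_of_bits (l : seq bool) : nat :=
  if l is b :: l' then b + (nat_of_bits l').*2 else 0.

Lemma value_nth l L : size l <= L -> value (fun k => nth false l k) L = nat_of_bits l.
Proof.
elim: l L => [|b l IH] [|L] //= le_L.
- by rewrite /value big_ord0.
- by rewrite /value big1 // => i _; rewrite nth_nil.
rewrite /value big_ord_recl muln1 -(IH L) //; congr (_ + _).
rewrite -mul2n /value big_distrr /=; apply: eq_bigr => i _.
by rewrite expnS mulnCA.
Qed.

Lemma nat_of_bits_lt l : nat_of_bits l < 2 ^ size l.
Proof. by elim: l => //= b l IH; rewrite expnS; case: b; lia. Qed.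

Lemma nat_of_bits_gt0 l : l != [::] -> last true l -> 0 < nat_of_bits l.
Proof. by elim: l => //= -[] [|c l] IH _ hl //; have := IH isT hl; rewrite /=; lia. Qed.

(** [last true] expresses the absence of leading zeros; its default admits the empty word, which
    encodes 0. *)
Lemma nat_of_bits_inj l l' : last true l -> last true l' ->
  nat_of_bits l = nat_of_bits l' -> l = l'.
Proof.
have last_behead (b : bool) (k : seq bool) : last b k -> last true k by case: k.
elim: l l' => [|b l IH] [|c l'] //= hl hl' e.
- by have := @nat_of_bits_gt0 (c :: l') isT hl'; rewrite /= -e.
- by have := @nat_of_bits_gt0 (b :: l) isT hl; rewrite /= e.
have [bc ll'] : b = c /\ nat_of_bits l = nat_of_bits l'.
  by case: (b) (c) e => [] [] /= e; split=> //; lia.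
by rewrite bc (IH l') //; [apply: last_behead hl | apply: last_behead hl'].
Qed.

Lemma value_binary n L : value (fun k => odd (n %/ 2 ^ k)) L = n %% 2 ^ L.
Proof.
elim: L => [|L IH]; first by rewrite /value big_ord0 modn1.
rewrite /value big_ord_recr /= -/(value (fun k => odd (n %/ 2 ^ k)) L) IH.
have r_lt : n %% 2 ^ L < 2 ^ L by rewrite ltn_pmod ?expn_gt0.
have nE : n = (n %/ 2 ^ L)./2 * 2 ^ L.+1 + (n %% 2 ^ L + odd (n %/ 2 ^ L) * 2 ^ L).
  rewrite {1}(divn_eq n (2 ^ L)) -{1}(odd_double_half (n %/ 2 ^ L)).
  by rewrite mulnDl -muln2 expnS mulnA; lia.
rewrite [RHS](_ : _ = n %% 2 ^ L + odd (n %/ 2 ^ L) * 2 ^ L) //.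
by rewrite {1}nE modnMDl modn_small // expnS; case: odd; lia.
Qed.

Lemma nat_of_bits_bits n : nat_of_bits (bits n) = n.
Proof.
rewrite -(@value_nth _ (up_log 2 n.+1)) ?size_mkseq // /value.
under eq_bigr => i _ do rewrite nth_mkseq //.
rewrite -/(value (fun k => odd (n %/ 2 ^ k)) _) value_binary modn_small //.
exact: up_logP.
Qed.

Lemma last_bits n : last true (bits n).
Proof.
rewrite (last_nth true) /bits size_mkseq; case: n => [|n]; first by rewrite up_log1.
have := @up_log_bounds 2 n.+2 isT isT.
case: (up_log 2 n.+2) => [|L] // /andP[le_n lt_n].
rewrite /= nth_mkseq // (_ : n.+1 %/ 2 ^ L = 1) //.
by apply/eqP; rewrite eqn_leq leq_divRL ?expn_gt0 // -ltnS ltn_divLR ?expn_gt0 // -expnS mul1n lt_n -ltnS.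
Qed.

Lemma bitsK l : last true l -> bits (nat_of_bits l) = l.
Proof.
by move=> hl; apply: nat_of_bits_inj => //; [apply: last_bits | rewrite nat_of_bits_bits].
Qed.

Lemma size_bits_nat n : n < 2 ^ size (bits n).
Proof. by rewrite -{1}(nat_of_bits_bits n) nat_of_bits_lt. Qed.

Definition join (fs : seq (seq bool)) : seq sym :=
  flatten [seq [seq Some b | b <- f] ++ [:: None] | f <- fs].

Lemma join_cat fs gs : join (fs ++ gs) = join fs ++ join gs.
Proof. by rewrite /join map_cat flatten_cat. Qed.

Lemma join_cons f fs : join (f :: fs) = [seq Some b | b <- f] ++ None :: join fs.
Proof. by rewrite /join /= -catA. Qed.

(** Even a malformed word splits this way, so the field functions have a meaning before any check
    has succeeded. *)
Lemma join_tail (x : seq sym) : exists fs t, x = join fs ++ [seq Some b | b <- t].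
Proof.
elim: x => [|[b|] x [fs [t ->]]]; first by exists [::], [::].
- case: fs => [|f fs]; first by exists [::], (b :: t).
  by exists ((b :: f) :: fs), t; rewrite !join_cons.
- by exists ([::] :: fs), t; rewrite join_cons.
Qed.

Lemma count_join fs m t i : m <= size fs ->
  (count_mem None (take i (join fs ++ [seq Some b | b <- t])) < m) =
  (i < size (join (take m fs))).
Proof.
have count_Some (l : seq bool) : count_mem None [seq (Some b : sym) | b <- l] = 0.
  by elim: l.
elim: fs m i => [|f fs IH] [|m] i //= le_m; rewrite ?ltn0 ?ltnS //.
rewrite !join_cons -catA /= size_cat /= size_map take_cat size_map.
case: ltnP => [lt_i|le_i].
  by rewrite -map_take count_Some; lia.
rewrite count_cat count_Some add0n; case: {2}(i - size f) (erefl (i - size f)) => [|j] ij.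
  by rewrite ij /=; lia.
rewrite ij /= add1n IH; last exact: le_m.
have -> : i = size f + j.+1 by lia.
by rewrite ltn_add2l ltnS.
Qed.

Lemma onth_letter (x : seq sym) (u : seq bool) i : onth (word_pair x u) i =
  if i < size x then omap inl (onth x i) else omap inr (onth u (i - size x)).
Proof. by rewrite /word_pair onth_cat size_map !onth_map. Qed.

Lemma sum_ltn p L : p <= L -> \sum_(i < L) (i < p) = p.
Proof.
move=> le_p; rewrite -(big_mkord xpredT (fun i => nat_of_bool (i < p))).
rewrite (big_cat_nat (leq0n p) le_p) /= [X in _ + X]big_nat [X in _ + X]big1 ?addn0; last first.
  by move=> i /andP[le_i _]; rewrite ltnNge le_i.
rewrite big_nat (eq_bigr (fun=> 1)) => [|i /andP[_ ->]//].
by rewrite -big_nat sum_nat_const_nat subn0 muln1.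
Qed.

Section Parse.
Variables (x : seq sym) (u : seq bool).
Let z := word_pair x u.

Lemma size_word : size z = size x + size u.
Proof. by rewrite /z /word_pair size_cat !size_map. Qed.

Lemma input_size_word : input_size z = size x.
Proof.
rewrite /input_size size_word big_split_ord /=.
rewrite [X in _ + X]big1 ?addn0 => [|i _]; last first.
  by rewrite onth_letter ltnNge leq_addr /=; case: onth.
rewrite -[RHS]mul1n -[in RHS](card_ord (size x)) mulnC -sum_nat_const.
apply: eq_bigr => i _; rewrite onth_letter ltn_ord.
by have := onthTE x i; rewrite ltn_ord; case: onth.
Qed.

Lemma seps_word i : seps z i = count_mem None (take i x).
Proof.
elim: i => [|i IH]; first by rewrite /seps big_ord0 take0.
rewrite /seps big_ord_recr /= -/(seps z i) IH onth_letter.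
case: ltnP => [lt_i|le_i].
  rewrite (take_nth None lt_i) -cats1 count_cat /= addn0; congr (_ + _).
  by rewrite -(odflt_onth None); have := onthTE x i; rewrite lt_i; case: onth => // -[].
by rewrite !take_oversize ?(leqW le_i) //; case: (onth u _) => [b|]; rewrite addn0.
Qed.

Lemma fields_word : fields z = count_mem None x.
Proof. by rewrite /fields seps_word take_oversize // size_word leq_addr. Qed.

Variables (fs : seq (seq bool)) (t : seq bool).
Hypothesis xE : x = join fs ++ [seq Some b | b <- t].

Lemma fields_join : fields z = size fs.
Proof.
rewrite fields_word xE count_cat; have -> : count_mem None [seq (Some b : sym) | b <- t] = 0.
  by elim: t.
rewrite addn0; elim: fs => //= f l IH; rewrite join_cons count_cat /= IH.
by rewrite (_ : count_mem _ _ = 0) //; elim: f.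
Qed.

Lemma start_join m : m <= size fs -> start z m = size (join (take m fs)).
Proof.
move=> le_m; rewrite /start.
under eq_bigr do rewrite seps_word {1}xE count_join //.
rewrite sum_ltn // size_word xE -{2}(cat_take_drop m fs) join_cat !size_cat.
by rewrite -!addnA leq_addr.
Qed.

Lemma field_size_join m : m < size fs -> field_size z m = size (nth [::] fs m).
Proof.
move=> lt_m; rewrite /field_size !start_join ?(ltnW lt_m) //.
rewrite (take_nth [::] lt_m) -cats1 join_cat size_cat addKn.
by rewrite join_cons size_cat size_map addn1.
Qed.

Lemma field_bit_join m k : m < size fs -> k < size (nth [::] fs m) ->
  field_bit z m k = nth false (nth [::] fs m) k.
Proof.
move=> lt_m lt_k; rewrite /field_bit start_join ?(ltnW lt_m) //.
rewrite onth_letter {2}xE -{2}(cat_take_drop m fs) join_cat -catA onth_cat.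
have -> : (size (join (take m fs)) + k < size (join (take m fs))) = false by lia.
rewrite addKn (drop_nth [::] lt_m) join_cons -catA onth_cat size_map lt_k.
rewrite ifT; last first.
  rewrite xE -{2}(cat_take_drop m fs) (drop_nth [::] lt_m) join_cat join_cons.
  by rewrite !size_cat size_map; lia.
by rewrite onth_map -(odflt_onth false); have := onthTE (nth [::] fs m) k; rewrite lt_k;
  case: onth => // -[].
Qed.

End Parse.

Lemma size_join_nth fs m : m < size fs -> size (nth [::] fs m) < size (join fs).
Proof.
move=> lt_m; rewrite -[in join fs](cat_take_drop m fs) (drop_nth [::] lt_m).
by rewrite join_cat join_cons !size_cat size_map /=; lia.
Qed.

Lemma size_join_ge fs : size fs <= size (join fs).
Proof. by elim: fs => //= f fs IH; rewrite join_cons size_cat /= ; lia. Qed.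

Section Triples.
Variables (A B : Type) (f g h : A -> B) (b0 : B).

Definition triples (s : seq A) : seq B := flatten [seq [:: f a; g a; h a] | a <- s].

Lemma size_triples s : size (triples s) = 3 * size s.
Proof. by elim: s => //= a s IH; rewrite /triples /= -/(triples s) IH; lia. Qed.

Lemma nth_triples s a0 e : e < size s ->
  [/\ nth b0 (triples s) (3 * e) = f (nth a0 s e),
      nth b0 (triples s) (3 * e).+1 = g (nth a0 s e) &
      nth b0 (triples s) (3 * e).+2 = h (nth a0 s e)].
Proof.
by elim: s e => [|a s IH] [|e] // lt_e; rewrite mulnS; apply: (IH e).
Qed.

Lemma triplesP n (fs : seq B) : size fs = 3 * n ->
  (forall e, e < n -> exists a, [/\ f a = nth b0 fs (3 * e),
     g a = nth b0 fs (3 * e).+1 & h a = nth b0 fs (3 * e).+2]) ->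
  exists2 s, size s = n & fs = triples s.
Proof.
elim: n fs => [|n IH] fs; first by rewrite muln0 => /size0nil-> _; exists [::].
case: fs => [|b1 [|b2 [|b3 fs]]]; rewrite mulnS // => -[sz] hfs.
have [a [fa ga ha]] := hfs 0 isT.
have [|e lt_e|s <- ->] := IH fs; first exact: sz.
  by have := hfs e.+1 lt_e; rewrite mulnS.
by exists (a :: s) => //; rewrite /triples /= fa ga ha.
Qed.

End Triples.

Definition member_field (K : nat) (B : itemset K) : seq bool := [seq i \in B | i <- enum 'I_K].
Definition num_field (r : rat) : seq bool := (r < 0)%R :: bits `|numq r|%N.
Definition den_field (r : rat) : seq bool := bits `|denq r|%N.

Definition entry_fields (K : nat) (es : seq (itemset K * rat)) : seq (seq bool) :=
  triples (fun e => member_field e.1) (fun e => num_field e.2) (fun e => den_field e.2) es.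

Lemma size_entry_fields K (es : seq (itemset K * rat)) :
  size (entry_fields es) = 3 * size es.
Proof. exact: size_triples. Qed.

Lemma encode_entry (K : nat) (B : itemset K) (r : rat) :
  enc_itemset B ++ enc_rat r = join [:: member_field B; num_field r; den_field r].
Proof.
by rewrite !join_cons /join /= /enc_itemset /enc_rat /member_field -catA /= -map_comp.
Qed.

Lemma entry_fields_cons (K : nat) (e : itemset K * rat) es :
  entry_fields (e :: es) =
    [:: member_field e.1; num_field e.2; den_field e.2] ++ entry_fields es.
Proof. by []. Qed.

Lemma encodeE (I : query) : encode I =
  join (entry_fields ((q_target I, q_bound I) ::
    [seq (tnth (q_fam I) j, tnth (q_theta I) j) | j <- enum 'I_(q_N I)])).
Proof.
rewrite /encode catA encode_entry entry_fields_cons join_cat; congr (_ ++ _).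
elim: (enum _) => //= j s IH.
by rewrite encode_entry IH entry_fields_cons join_cat.
Qed.

(** Coprimality makes [numq] and [denq] return the given numbers, the top digits make [bits] return
    the given words, and excluding negative zero makes the sign bit agree with [r < 0]. *)
Lemma rat_of_fields (s : bool) (n d : seq bool) :
  last true n -> last true d -> d != [::] -> (s -> n != [::]) ->
  coprime (nat_of_bits n) (nat_of_bits d) ->
  exists r, num_field r = s :: n /\ den_field r = d.
Proof.
move=> hn hd d0 sn co; pose a : int := ((-1) ^+ s * (nat_of_bits n)%:Z)%R.
have d_gt0 := nat_of_bits_gt0 d0 hd.
have abs_a : `|a|%N = nat_of_bits n by rewrite abszMsign.
exists (a%:~R / (nat_of_bits d)%:Z%:~R)%R.
rewrite /num_field /den_field coprimeq_num ?coprimeq_den /= ?abs_a //.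
rewrite eqz_nat gtn_eqF //= Num.Theory.gtr0_sg ?ltz_nat // GRing.mul1r abs_a bitsK //.
split; last by rewrite bitsK.
congr (_ :: _); rewrite Num.Theory.pmulr_llt0 ?Num.Theory.invr_gt0 ?ltr0z ?ltz_nat //.
rewrite ltrz0 /a; case: s sn {a abs_a} => [/(_ isT)|_].
  by move=> n0; rewrite GRing.mulN1r Num.Theory.oppr_lt0 ltz_nat nat_of_bits_gt0.
by rewrite GRing.mul1r.
Qed.

Lemma same_conv W x y x' y' :
  value x W * value y W < 2 ^ (4 * W) -> value x' W * value y' W < 2 ^ (4 * W) ->
  same (conv W x y) (conv W x' y') (4 * W) =
  (value x W * value y W == value x' W * value y' W).
Proof. by move=> lt1 lt2; rewrite same_value ?value_conv // leq_mul2r orbT. Qed.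

Lemma less_conv W x y x' y' :
  value x W * value y W < 2 ^ (4 * W) -> value x' W * value y' W < 2 ^ (4 * W) ->
  less (conv W x y) (conv W x' y') (4 * W) =
  (value x W * value y W < value x' W * value y' W).
Proof. by move=> lt1 lt2; rewrite less_value ?value_conv // leq_mul2r orbT. Qed.

Lemma width_gt0 z : 0 < width z.
Proof. by []. Qed.

Lemma value_sum W n (b : nat -> bool) (X : nat -> nat -> nat) :
  value (fun k => \sum_(a < n) b a * X a k) W = \sum_(a < n) b a * value (X a) W.
Proof.
rewrite /value; under eq_bigr do rewrite big_distrl /=.
rewrite exchange_big /=; apply: eq_bigr => a _; rewrite big_distrr /=.
by apply: eq_bigr => k _; rewrite mulnA.
Qed.

Lemma value_add1 x L : 0 < L -> value (fun k => x k + (k == 0)) L = value x L + 1.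
Proof.
case: L => // L _; rewrite /value; under eq_bigr do rewrite mulnDl.
by rewrite big_split /=; congr addn; rewrite big_ord_recl big1.
Qed.

Section ReadFields.
Variables (x : seq sym) (u : seq bool) (fs : seq (seq bool)) (e : nat).
Let z := word_pair x u.
Hypothesis xE : x = join fs.
Hypothesis lt_e : (3 * e).+2 < size fs.

Let f0 := nth [::] fs (3 * e).
Let f1 := nth [::] fs (3 * e).+1.
Let f2 := nth [::] fs (3 * e).+2.

Let xE0 : x = join fs ++ [seq Some b | b <- [::]].
Proof. by rewrite cats0. Qed.

Let lt_e1 : (3 * e).+1 < size fs. Proof. exact: ltnW. Qed.
Let lt_e0 : 3 * e < size fs. Proof. exact: ltnW. Qed.

Let size_lt m : m < size fs -> size (nth [::] fs m) <= width z.
Proof.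
move=> lt_m; have := size_join_nth lt_m; rewrite -xE /width input_size_word.
by move=> lt_x; rewrite mulnS; lia.
Qed.

Lemma size_field0 : field_size z (3 * e) = size f0.
Proof. exact: (field_size_join u xE0 lt_e0). Qed.

Lemma size_field1 : field_size z (3 * e).+1 = size f1.
Proof. exact: (field_size_join u xE0 lt_e1). Qed.

Lemma num_sizeE : num_size z e = size (behead f1).
Proof. by rewrite /num_size size_field1 size_behead. Qed.

Lemma den_sizeE : den_size z e = size f2.
Proof. exact: (field_size_join u xE0 lt_e). Qed.

Lemma memberE k : k < size f0 -> member z e k = nth false f0 k.
Proof. exact: (field_bit_join u xE0 lt_e0). Qed.

Lemma negativeE : f1 != [::] -> negative z e = head false f1.
Proof.
move=> f1n; rewrite -nth0; apply: (field_bit_join u xE0 lt_e1).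
by rewrite lt0n size_eq0.
Qed.

Lemma numE k : num z e k = nth false (behead f1) k.
Proof.
rewrite /num num_sizeE nth_behead; case: ltnP => [lt_k|le_k] /=.
  by apply: (field_bit_join u xE0 lt_e1); move: lt_k; rewrite size_behead -/f1; lia.
by rewrite nth_default //; move: le_k; rewrite size_behead; lia.
Qed.

Lemma denE k : den z e k = nth false f2 k.
Proof.
rewrite /den den_sizeE; case: ltnP => [lt_k|le_k] /=; last by rewrite nth_default.
exact: (field_bit_join u xE0 lt_e).
Qed.

Lemma value_num : value (fun k => num z e k) (width z) = nat_of_bits (behead f1).
Proof.
rewrite -(@value_nth _ (width z)); last first.
  by rewrite size_behead; have := size_lt lt_e1; rewrite -/f1; lia.
by apply: eq_bigr => k _; rewrite numE.
Qed.

Lemma value_den : value (fun k => den z e k) (width z) = nat_of_bits f2.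
Proof.
rewrite -(@value_nth _ (width z)); last exact: size_lt.
by apply: eq_bigr => k _; rewrite denE.
Qed.

Definition bezout (v w : nat) : bool := v * nat_of_bits f2 == w * nat_of_bits (behead f1) + 1.

Lemma check_entryE : check_entry z e =
  [&& size f0 == attrs z, f1 != [::], last true (behead f1),
      head false f1 ==> (behead f1 != [::]), f2 != [::], last true f2 &
      bezout (value (fun k => cert z 3 e k) (width z))
             (value (fun k => cert z 2 e k) (width z))].
Proof.
rewrite /check_entry size_field0; congr andb.
rewrite size_field1 lt0n size_eq0; case: (boolP (f1 == [::])) => //= f1n.
rewrite num_sizeE den_sizeE negativeE // numE denE !lt0n !size_eq0.
rewrite (last_nth true) (last_nth true).
congr andb; first by case: (behead f1) => //= b l; rewrite (set_nth_default true).
congr andb; rewrite -andbA; case: (boolP (f2 == [::])) => //= f2n.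
congr andb; first by case: (f2) f2n => //= b l _; rewrite (set_nth_default true).
set W := width z.
have le2 (n m : nat) : n < 2 ^ W -> m < 2 ^ W -> (n * m).+1 < 2 ^ (4 * W).
  move=> hn hm; have := width_gt0 z; rewrite -/W => W_gt0.
  apply: (@leq_ltn_trans (2 ^ (2 * W))).
    by rewrite mul2n -addnn expnD; nia.
  by rewrite ltn_exp2l //; lia.
pose V := value (fun k => cert z 3 e k) W.
pose U := value (fun k => cert z 2 e k) W.
have hV : V < 2 ^ W by apply: value_bool_lt.
have hU : U < 2 ^ W by apply: value_bool_lt.
have hn : value (fun k => num z e k) W < 2 ^ W by apply: value_bool_lt.
have hd : value (fun k => den z e k) W < 2 ^ W by apply: value_bool_lt.
have le24 : 2 * W <= 4 * W by rewrite leq_mul2r orbT.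
have v1 : value (fun k => conv W (fun k => cert z 2 e k) (fun k => num z e k) k + (k == 0)) (4 * W)
    = U * nat_of_bits (behead f1) + 1.
  by rewrite value_add1 ?muln_gt0 // value_conv // value_num.
have v2 : value (conv W (fun k => cert z 3 e k) (fun k => den z e k)) (4 * W)
    = V * nat_of_bits f2.
  by rewrite value_conv // value_den.
rewrite same_value ?v1 ?v2 //.
  by rewrite -value_den ltnW // le2.
by rewrite -value_num addn1 le2.
Qed.

End ReadFields.

(** * Reading an encoded query *)

Lemma bezout_coprime v d w n : v * d = w * n + 1 -> coprime n d.
Proof.
move=> e; rewrite /coprime -dvdn1.
by rewrite -(@dvdn_addr (w * n)) ?dvdn_mull ?dvdn_gcdl // -e dvdn_mull ?dvdn_gcdr.
Qed.

(** The size bounds ensure that both coefficients fit into a certificate row. *)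
Lemma coprime_bezout n d : 0 < d -> coprime n d ->
  exists v w, v * d = w * n + 1 /\ v <= w * n + 1 /\ w < d.
Proof.
move=> d_gt0 co; case: (Bezoutl n d_gt0) => w lt_wd.
rewrite gcdnC (eqP co) addnC => /dvdnP[v e]; exists v, w; split=> //; split=> //.
by rewrite e leq_pmulr.
Qed.

Lemma entries_word x u n fs : x = join fs -> size fs = 3 * n ->
  entries (word_pair x u) = n.
Proof.
move=> xE sz; rewrite /entries (@fields_join _ u fs [::]) ?cats0 // sz.
under eq_bigr do rewrite leq_pmul2l //.
by rewrite sum_ltn // leq_pmull.
Qed.

Lemma check_layout_join x u : check_layout (word_pair x u) -> exists2 fs,
  x = join fs & size fs = 3 * entries (word_pair x u).
Proof.
have [fs [t xE]] := join_tail x.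
case/and4P=> /eqP st /eqP sz _ _; rewrite (fields_join _ xE) in st sz.
exists fs => //; move: st; rewrite (start_join _ xE) // take_size input_size_word.
rewrite xE size_cat size_map -[LHS]addn0 => /addnI/esym/size0nil t0.
by rewrite t0 cats0.
Qed.

Lemma member_fieldK (f : seq bool) :
  member_field [set i : 'I_(size f) | nth false f i] = f.
Proof.
rewrite /member_field -[RHS](mkseq_nth false) /mkseq -val_enum_ord -map_comp.
by apply: eq_map => i; rewrite inE.
Qed.

Lemma nth_member_field K (B : itemset K) (i : 'I_K) :
  nth false (member_field B) i = (i \in B).
Proof. by rewrite (nth_map i) ?nth_ord_enum // size_enum_ord. Qed.

Lemma size_member_field K (B : itemset K) : size (member_field B) = K.
Proof. by rewrite size_map size_enum_ord. Qed.

Lemma decode x u : check_layout (word_pair x u) ->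
  all (check_entry (word_pair x u)) (iota 0 (entries (word_pair x u))) ->
  exists K (es : seq (itemset K * rat)),
    [/\ 0 < K, 0 < size es & x = join (entry_fields es)].
Proof.
set z := word_pair x u => lay ents; have [fs xE sz] := check_layout_join lay.
case/and4P: lay => _ _ E_gt0 K_gt0; pose K := size (nth [::] fs 0).
have attrsE : attrs z = K.
  by apply: (@field_size_join _ u fs [::]); rewrite ?cats0 // sz muln_gt0.
have [e lt_e|es sz_es fsE] := @triplesP _ _ (fun e : itemset K * rat => member_field e.1)
    (fun e => num_field e.2) (fun e => den_field e.2) [::] _ fs sz.
  have lt_fs : (3 * e).+2 < size fs by rewrite sz; lia.
  have /allP/(_ e) := ents; rewrite mem_iota /= => /(_ lt_e).
  rewrite (check_entryE u xE lt_fs) attrsE /bezout.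
  move: (nth _ fs (3 * e)) (nth _ fs (3 * e).+1) (nth _ fs (3 * e).+2) => f0 f1 f2.
  case: f1 => [|s n]; first by rewrite andbF.
  case/and5P=> /eqP f0K _ /= hn sn /and3P[d0 hd /eqP/bezout_coprime co].
  have [r [rn rd]] := rat_of_fields hn hd d0 (implyP sn) co.
  have [B BE] : exists B : itemset K, member_field B = f0.
    by rewrite -f0K; exists [set i : 'I_(size f0) | nth false f0 i]; apply: member_fieldK.
  by exists (B, r); rewrite BE rn rd.
exists K, es; split; rewrite ?sz_es // -?attrsE //.
by rewrite xE fsE.
Qed.

Section ReadEntries.
Variables (K : nat) (all_es : seq (itemset K * rat)) (x : seq sym) (u : seq bool).
Let z := word_pair x u.
Hypotheses (K_gt0 : 0 < K) (es_gt0 : 0 < size all_es).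
Hypothesis xE : x = join (entry_fields all_es).
Let entry e := nth (set0, 0%R : rat) all_es e.

Lemma entriesE : entries z = size all_es.
Proof. by apply: entries_word xE _; rewrite size_triples. Qed.

Let lt_fields e : e < size all_es -> (3 * e).+2 < size (entry_fields all_es).
Proof. by rewrite size_triples; lia. Qed.

Let fieldsE e : e < size all_es ->
  [/\ nth [::] (entry_fields all_es) (3 * e) = member_field (entry e).1,
      nth [::] (entry_fields all_es) (3 * e).+1 = num_field (entry e).2 &
      nth [::] (entry_fields all_es) (3 * e).+2 = den_field (entry e).2].
Proof. exact: nth_triples. Qed.

Lemma attrsE : attrs z = K.
Proof.
rewrite /attrs -[0](muln0 3) (size_field0 u xE (lt_fields es_gt0)).
by have [-> _ _] := fieldsE es_gt0; rewrite size_member_field.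
Qed.

Lemma check_layout_entries : check_layout z.
Proof.
rewrite /check_layout attrsE entriesE K_gt0 es_gt0 !andbT.
have xE' : x = join (entry_fields all_es) ++ [seq Some b | b <- [::]] by rewrite cats0.
rewrite (fields_join u xE') size_triples eqxx andbT.
rewrite -size_entry_fields (start_join u xE') //.
by rewrite take_size input_size_word -xE.
Qed.

Lemma member_entry e (i : 'I_K) : e < size all_es ->
  member z e i = (i \in (entry e).1).
Proof.
move=> lt_e; have [f0E _ _] := fieldsE lt_e.
by rewrite (memberE u xE (lt_fields lt_e)) f0E ?size_member_field // nth_member_field.
Qed.

Lemma negative_entry e : e < size all_es -> negative z e = ((entry e).2 < 0)%R.
Proof.
move=> lt_e; have [_ f1E _] := fieldsE lt_e.
by rewrite (negativeE u xE (lt_fields lt_e)) f1E.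
Qed.

Lemma num_entry e : e < size all_es ->
  value (fun k => num z e k) (width z) = `|numq (entry e).2|%N.
Proof.
move=> lt_e; have [_ f1E _] := fieldsE lt_e.
by rewrite (value_num u xE (lt_fields lt_e)) f1E nat_of_bits_bits.
Qed.

Lemma den_entry e : e < size all_es ->
  value (fun k => den z e k) (width z) = `|denq (entry e).2|%N.
Proof.
move=> lt_e; have [_ _ f2E] := fieldsE lt_e.
by rewrite (value_den u xE (lt_fields lt_e)) f2E nat_of_bits_bits.
Qed.

Lemma check_entry_entries e : e < size all_es -> check_entry z e =
  (value (fun k => cert z 3 e k) (width z) * `|denq (entry e).2| ==
   value (fun k => cert z 2 e k) (width z) * `|numq (entry e).2| + 1).
Proof.
move=> lt_e; have [f0E f1E f2E] := fieldsE lt_e.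
rewrite (check_entryE u xE (lt_fields lt_e)) /bezout attrsE.
rewrite f0E f1E f2E size_member_field eqxx /= !last_bits !nat_of_bits_bits /=.
have neq0 (n : nat) : n != 0 -> bits n != [::].
  by apply: contraNneq => n0; rewrite -(nat_of_bits_bits n) n0.
have -> : ((entry e).2 < 0)%R ==> (bits `|numq (entry e).2| != [::]).
  by apply/implyP => r_lt0; rewrite neq0 // absz_eq0 numq_eq0 Order.POrderTheory.lt_eqF.
have -> : den_field (entry e).2 != [::] by rewrite neq0 // absz_eq0 denq_eq0.
by [].
Qed.

Lemma all_attrs (P : nat -> bool) : all P (iota 0 (attrs z)) = [forall i : 'I_K, P i].
Proof.
rewrite attrsE; apply/allP/forallP => [h i|h k].
  by apply: h; rewrite mem_iota /=.
by rewrite mem_iota /= add0n => lt_k; apply: (h (Ordinal lt_k)).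
Qed.

Lemma all_entries (P : nat -> bool) : 
  reflect (forall e, e < size all_es -> P e) (all P (iota 0 (entries z))).
Proof.
rewrite entriesE; apply: (iffP allP) => h e; last by rewrite mem_iota; apply: h.
by move=> lt_e; apply: h; rewrite mem_iota.
Qed.

Lemma has_entries (P : nat -> bool) : 
  reflect (exists2 e, e < size all_es & P e) (has P (iota 0 (entries z))).
Proof.
rewrite entriesE; apply: (iffP hasP) => -[e lt_e Pe]; exists e => //.
  by move: lt_e; rewrite mem_iota.
by rewrite mem_iota.
Qed.

Lemma member_neq e e' : e < size all_es -> e' < size all_es ->
  has (fun k => member z e k != member z e' k) (iota 0 (attrs z)) =
  ((entry e).1 != (entry e').1).
Proof.
move=> lt_e lt_e'; rewrite -[LHS]negbK; congr negb; rewrite -all_predC all_attrs.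
apply/forallP/eqP => [h|h i] /=; last by rewrite !member_entry // h negbK eqxx.
by apply/setP => i; have := h i; rewrite /= negbK !member_entry // => /eqP.
Qed.

Lemma nth_family e : nth set0 (unzip1 (behead all_es)) e = (entry e.+1).1.
Proof.
rewrite /entry -nth_behead; case: (ltnP e (size (behead all_es))) => [lt_e|le_e].
  by rewrite (nth_map (set0, 0%R : rat)).
by rewrite !nth_default ?size_map.
Qed.

Lemma check_distinctE : check_distinct z = uniq (unzip1 (behead all_es)).
Proof.
have sz : size (unzip1 (behead all_es)) = (size all_es).-1 by rewrite size_map size_behead.
apply/all_entries/(uniqP set0) => [h|h e lt_e].
  have neq i j : i < j -> j < size (unzip1 (behead all_es)) ->
      nth set0 (unzip1 (behead all_es)) i != nth set0 (unzip1 (behead all_es)) j.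
    rewrite sz => lt_ij lt_j; have := h i.+1 ltac:(lia) => /= /all_entries /(_ j.+1 ltac:(lia)).
    by rewrite ltnS lt_ij /= member_neq ?nth_family //; lia.
  move=> i j; rewrite !inE => lt_i lt_j eq_ij; apply/eqP; case: (ltngtP i j) => // lt_ij.
    by have := neq i j lt_ij lt_j; rewrite eq_ij eqxx.
  by have := neq j i lt_ij lt_i; rewrite eq_ij eqxx.
apply/implyP => e_gt0; apply/all_entries => e' lt_e'; apply/implyP => lt_ee'.
rewrite member_neq //; apply/eqP => eq_e.
have := h e.-1 e'.-1; rewrite !inE sz !nth_family !prednK //; last by lia.
by move=> /(_ ltac:(lia) ltac:(lia) eq_e); lia.
Qed.

Lemma check_antimonotonicP :
  reflect (antimonotonic [in unzip1 (behead all_es)]) (check_antimonotonic z).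
Proof.
have sz : size (unzip1 (behead all_es)) = (size all_es).-1 by rewrite size_map size_behead.
apply: (iffP (all_entries _)) => [h|h e lt_e].
  suff del (B : itemset K) i : B \in unzip1 (behead all_es) -> i \in B ->
      B :\ i \in unzip1 (behead all_es).
    (* The attributes of [B] outside [C] are deleted one at a time. *)
    suff closed n (B C : itemset K) : #|B :\: C| <= n ->
        B \in unzip1 (behead all_es) -> C \subset B -> C \in unzip1 (behead all_es).
      by move=> B C; apply: closed (leqnn _).
    elim: n B => [|n IH] B le_n BF CB.
      have BC : B \subset C by rewrite -setD_eq0 -cards_eq0 -leqn0.
      by rewrite (_ : C = B) //; apply/eqP; rewrite eqEsubset CB.
    have [BC|/subsetPn[i iB iC]] := boolP (B \subset C).
      by rewrite (_ : C = B) //; apply/eqP; rewrite eqEsubset CB.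
    apply: (IH (B :\ i)); last 2 first.
    - exact: del.
    - by rewrite subsetD1 CB.
    rewrite -ltnS (leq_trans _ le_n) //; apply: proper_card; apply/properP; split.
      by rewrite setSD // subD1set.
    by exists i; rewrite !inE ?eqxx ?iB ?iC.
  case/(nthP set0) => j; rewrite sz => lt_j; rewrite nth_family => <- iB.
  have lt_j1 : j.+1 < size all_es by rewrite -ltn_predRL.
  have := h j.+1 lt_j1; rewrite /= all_attrs => /forallP/(_ i).
  rewrite (member_entry _ lt_j1) iB /=.
  case/has_entries => -[|e'] //= lt_e'; rewrite all_attrs => /forallP hB.
  apply/(nthP set0); exists e'; first by rewrite sz ltn_predRL.
  rewrite nth_family; apply/setP => l; have := hB l.
  by rewrite (member_entry _ lt_e') (member_entry _ lt_j1) !inE andbC => /eqP.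
apply/implyP => e_gt0; rewrite all_attrs; apply/forallP => i.
rewrite member_entry //; apply/implyP => ie.
have /(nthP set0)[e'] : (entry e).1 :\ i \in unzip1 (behead all_es).
  suff eF : (entry e).1 \in unzip1 (behead all_es) by apply: (h _ _ eF); apply: subD1set.
  by rewrite -(prednK e_gt0) -nth_family mem_nth // sz ltn_predRL prednK.
rewrite sz nth_family ltn_predRL => lt_e' e'E; apply/has_entries; exists e'.+1 => //.
rewrite /= all_attrs; apply/forallP => l.
by rewrite (member_entry _ lt_e) (member_entry _ lt_e') e'E !inE andbC.
Qed.

Definition weight (a : nat) := value (fun k => cert z 1 a k) (width z).

Definition vect (a : nat) : K.-tuple bool := [tuple of mkseq (cert z 0 a) K].

Definition total_weight := \sum_(a < width z) weight a.

Definition covered_weight (e : nat) :=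
  \sum_(a < width z) [forall i in (entry e).1, tnth (vect a) i] * weight a.

Lemma containsE e a : e < size all_es ->
  contains z e a = [forall i in (entry e).1, tnth (vect a) i].
Proof.
move=> lt_e; rewrite /contains all_attrs.
have vectE (i : 'I_K) : tnth (vect a) i = cert z 0 a i by rewrite (tnth_nth false) nth_mkseq.
apply/forallP/forallP => h i; have := h i.
  by rewrite (member_entry i lt_e) vectE.
by rewrite (member_entry i lt_e) vectE.
Qed.

Lemma value_total : value (total z) (width z) = total_weight.
Proof.
have -> : total_weight = \sum_(a < width z) xpredT (a : nat) * weight a.
  by apply: eq_bigr => a _; rewrite mul1n.
rewrite -(value_sum _ _ xpredT (fun a k => cert z 1 a k)); apply: eq_bigr => k _; congr (_ * _).
by apply: eq_bigr => a _; rewrite mul1n.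
Qed.

Lemma value_covered e : e < size all_es ->
  value (covered z e) (width z) = covered_weight e.
Proof.
move=> lt_e; rewrite /covered (value_sum _ _ (contains z e) (fun a k => cert z 1 a k)).
by apply: eq_bigr => a _; rewrite containsE.
Qed.

Lemma covered_le e : covered_weight e <= total_weight.
Proof. by apply: leq_sum => a _; rewrite -[leqRHS]mul1n leq_mul2r leq_b1 orbT. Qed.

Let W := width z.

Lemma total_lt : total_weight < 2 ^ (2 * W).
Proof.
have lt_w a : weight a < 2 ^ W by apply: value_bool_lt.
apply: (@leq_ltn_trans (W * (2 ^ W).-1)).
  rewrite -[X in X * _]card_ord -sum_nat_const leq_sum // => a _.
  by have := lt_w a; lia.
have p_gt0 : 0 < 2 ^ W by rewrite expn_gt0.
rewrite mul2n -addnn expnD; apply: (@leq_ltn_trans (2 ^ W * (2 ^ W).-1)).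
  by rewrite leq_mul2r orbC ltnW // ltn_expl.
by rewrite ltn_pmul2l // prednK.
Qed.

(** A sum of W weights is below 2^(2W) and a further W-bit factor gives 2^(3W), so [4 * W] positions
    leave room for every comparison. *)
Lemma weight_mul_lt c (b : nat -> bool) : c <= total_weight ->
  c * value b W < 2 ^ (4 * W).
Proof.
move=> le_c; apply: (@leq_trans (2 ^ (2 * W) * 2 ^ W)).
  apply: (@leq_ltn_trans (total_weight * 2 ^ W)).
    by rewrite leq_mul // ltnW // value_bool_lt.
  by rewrite ltn_pmul2r ?expn_gt0 // total_lt.
by rewrite -expnD leq_exp2l //; lia.
Qed.

Lemma check_frequencyE e : e < size all_es -> check_frequency z e =
  ((0 < e) ==> (0 <= (entry e).2)%R &&
   (covered_weight e * `|denq (entry e).2| == total_weight * `|numq (entry e).2|)).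
Proof.
move=> lt_e; rewrite /check_frequency negative_entry // -Order.TotalTheory.leNgt.
rewrite same_conv ?value_covered ?value_total ?weight_mul_lt ?covered_le //.
by rewrite num_entry ?den_entry.
Qed.

Lemma check_boundE : check_bound z = (0 < total_weight) &&
  (((entry 0).2 < 0)%R ||
   (total_weight * `|numq (entry 0).2| < covered_weight 0 * `|denq (entry 0).2|)).
Proof.
rewrite /check_bound negative_entry //.
rewrite less_conv ?value_covered ?value_total ?weight_mul_lt ?covered_le //.
rewrite num_entry ?den_entry //; congr andb.
have k_in (k : 'I_(width z)) : (k : nat) \in iota 0 (width z).
  by rewrite mem_iota leq0n add0n ltn_ord.
rewrite -value_total /value lt0n sum_nat_eq0 negb_forall; apply/hasP/existsP => -[k].
  rewrite mem_iota /= add0n => lt_k tk; exists (Ordinal lt_k).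
  by rewrite /= -lt0n muln_gt0 tk expn_gt0.
by rewrite -lt0n muln_gt0 => /andP[tk _]; exists (k : nat).
Qed.

End ReadEntries.

(** * Correctness of the verifier *)

Section Correctness.
Import Order.TTheory GRing.Theory Num.Theory.
Variable R : realType.

Definition covers (K : nat) (B : itemset K) (w : K.-tuple bool) : bool :=
  [forall i in B, tnth w i].

Lemma freqE (K : nat) (p : {ffun K.-tuple bool -> R}) (B : itemset K) :
  freq p B = (\sum_w p w *+ covers B w)%R.
Proof. by rewrite /freq big_mkcond; apply: eq_bigr => w _; rewrite mulrb. Qed.

Lemma ratr_num (r : rat) : (0 <= r)%R ->
  (ratr r * (`|denq r|%N)%:R = (`|numq r|%N)%:R :> R)%R.
Proof.
move=> r_ge0; rewrite -[r in ratr r]divq_num_den fmorph_div /= !ratr_int.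
rewrite !natr_absz (ger0_norm (denq_ge0 r)) divfK ?intr_eq0 ?denq_eq0 //.
by rewrite ger0_norm // numq_ge0.
Qed.

(** The dependent record becomes a list of pairs; the consistency required by [admissible] is
    recovered from [q]. *)
Lemma MaxQueryDecP (x : seq sym) : MaxQueryDec R x <->
  exists K (B : itemset K) (b : rat) (es : seq (itemset K * rat)),
  [/\ x = join (entry_fields ((B, b) :: es)), 0 < K, uniq (unzip1 es),
      antimonotonic [in unzip1 es] &
      exists q : {ffun K.-tuple bool -> R},
      [/\ distribution q, forall e, e \in es -> freq q e.1 = ratr e.2 &
          (ratr b < freq q B)%R]].
Proof.
split=> [[I [-> [K_gt0 fam_uniq anti _] [q [dq sq bq]]]]|].
  exists (q_K I), (q_target I), (q_bound I),
    [seq (tnth (q_fam I) j, tnth (q_theta I) j) | j <- enum 'I_(q_N I)].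
  have famE : unzip1 [seq (tnth (q_fam I) j, tnth (q_theta I) j) | j <- enum 'I_(q_N I)]
      = q_fam I by rewrite /unzip1 -map_comp map_tnth_enum.
  split; rewrite ?famE //; first exact: encodeE.
  by exists q; split=> // _ /mapP[j _ ->]; apply: sq.
move=> [K [B [b [es [-> K_gt0 es_uniq anti [q [dq sq bq]]]]]]].
pose I := @Query K (size es) (map_tuple fst (in_tuple es))
  (map_tuple snd (in_tuple es)) B b.
have q_sat : satisfies (q_fam I) (q_theta I) q.
  by move=> j; rewrite !tnth_map; apply: sq; apply: mem_tnth.
exists I; split; last by exists q.
  rewrite encodeE; congr (join (entry_fields (_ :: _))).
  rewrite -[LHS](map_tnth_enum (in_tuple es)); apply: eq_map => j.
  by rewrite !tnth_map -surjective_pairing.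
by split=> //; exists q.
Qed.

Lemma verify_sound x u : verify (word_pair x u) -> MaxQueryDec R x.
Proof.
set z := word_pair x u; case/and5P=> lay ents dist anti /andP[freqs bnd].
have [K [all_es [K_gt0 es_gt0 xE]]] := decode lay ents.
case: all_es es_gt0 xE => [//|[B b] es] es_gt0 xE.
pose all_es := (B, b) :: es; pose W := width z.
pose wt a := weight x u a; pose v a := vect K x u a.
pose D := total_weight x u.
have {bnd} := bnd; rewrite (check_boundE u K_gt0 es_gt0 xE) => /andP[D_gt0 bnd].
have D_neq0 : (D%:R != 0 :> R)%R by rewrite pnatr_eq0 -lt0n.
(* The certificate may list a vector repeatedly; [q] adds up the weights of equal vectors. *)
pose q : {ffun K.-tuple bool -> R} :=
  [ffun w => ((\sum_(a < W) (v a == w) * wt a)%:R / D%:R)%R].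
have qE (P : pred (K.-tuple bool)) :
    (\sum_w q w *+ P w = (\sum_(a < W) P (v a) * wt a)%N%:R / D%:R)%R.
  under eq_bigr do rewrite ffunE -mulrnAl; rewrite -mulr_suml; congr (_ / _)%R.
  under eq_bigr do rewrite -mulr_natr -natrM.
  rewrite -natr_sum; congr (_%:R)%R; under eq_bigr do rewrite big_distrl /=.
  rewrite exchange_big /=; apply: eq_bigr => a _.
  rewrite (bigD1 (v a)) //= eqxx mul1n mulnC big1 ?addn0 // => w /negPf neq_w.
  by rewrite eq_sym neq_w.
have cov e : e < size all_es ->
    (freq q (nth (set0, 0%R : rat) all_es e).1 = (covered_weight all_es x u e)%:R / D%:R)%R.
  by move=> lt_e; rewrite freqE qE.
apply/MaxQueryDecP; exists K, B, b, es; split=> //.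
- by rewrite (check_distinctE u K_gt0 es_gt0 xE) in dist.
- exact: (elimT (check_antimonotonicP u K_gt0 es_gt0 xE) anti).
exists q; split.
- split=> [w|]; first by rewrite ffunE divr_ge0 ?ler0n.
  have := qE xpredT; under eq_bigr do rewrite mulr1n; move=> ->.
  rewrite (_ : (\sum_(a < W) _)%N = D) ?divff //.
  by apply: eq_bigr => a _; rewrite mul1n.
- move=> e e_in; have lt_i : (index e es).+1 < size all_es by rewrite ltnS index_mem.
  have /(all_entries u xE)/(_ _ lt_i) := freqs.
  rewrite (check_frequencyE u K_gt0 es_gt0 xE lt_i) /= nth_index //.
  case/andP=> r_ge0 /eqP eq_cov; have := cov _ lt_i; rewrite /= nth_index // => ->.
  have den_neq0 : ((`|denq e.2|%N)%:R != 0 :> R)%R by rewrite pnatr_eq0 absz_eq0 denq_eq0.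
  apply: (mulIf D_neq0); rewrite divfK //; apply: (mulIf den_neq0).
  by rewrite mulrAC ratr_num // -!natrM eq_cov mulnC.
have := cov 0 isT; rewrite /= => ->; case/orP: bnd => /= [b_lt0|lt_cov].
  by apply: (@lt_le_trans _ _ 0%R); rewrite ?divr_ge0 // ltrq0.
have [b_lt0|b_ge0] := ltP b 0%R.
  by apply: (@lt_le_trans _ _ 0%R); rewrite ?divr_ge0 // ltrq0.
rewrite ltr_pdivlMr ?ltr0n //.
have den_gt0 : (0 < (`|denq b|%N)%:R :> R)%R by rewrite ltr0n absz_gt0 denq_eq0.
by rewrite -(ltr_pM2r den_gt0) mulrAC ratr_num // -!natrM ltr_nat mulnC.
Qed.

Lemma factorial_le n : n`! <= 2 ^ (n * n).
Proof.
elim: n => // n IH; rewrite factS.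
apply: (@leq_trans (2 ^ n.+1 * 2 ^ (n * n))); first by rewrite leq_mul // ltnW // ltn_expl.
by rewrite -expnD leq_exp2l //; nia.
Qed.

(** Each denominator is written in its own part of the word, so the bit lengths add up to at most
    the word's length. *)
Lemma prod_den_le (K : nat) (es : seq (itemset K * rat)) :
  \prod_(e <- es) `|denq e.2| <= 2 ^ size (join (entry_fields es)).
Proof.
elim: es => [|e es IH]; first by rewrite big_nil expn_gt0.
rewrite big_cons entry_fields_cons join_cat size_cat expnD leq_mul //.
rewrite ltnW // (leq_trans (size_bits_nat _)) // leq_exp2l // ltnW //.
exact: (@size_join_nth [:: member_field e.1; num_field e.2; den_field e.2] 2).
Qed.

(** The quotients and remainders invert the index [(t * W + a) * W + j] used by [cert]. *)
Definition certificate (W : nat) (C : nat -> nat -> nat -> bool) : seq bool :=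
  mkseq (fun i => C (i %/ (W * W)) ((i %/ W) %% W) (i %% W)) (4 * W * W).

Lemma cert_certificate x C t a k : let W := (size x).+1 * (size x).+1 in
  t < 4 -> a < W -> k < W ->
  cert (word_pair x (certificate W C)) t a k = C t a k.
Proof.
move=> W lt_t lt_a lt_k; rewrite /cert /width !input_size_word -/W onth_letter.
rewrite ltnNge leq_addr /= addKn; set i := _ + k.
have iW : i %/ W = t * W + a by rewrite /i divnMDl ?divn_small ?addn0 ?(leq_ltn_trans _ lt_k).
have lt_i : i < 4 * W * W.
  rewrite -ltn_divLR ?(leq_ltn_trans _ lt_k) // iW.
  by apply: (@leq_trans (t.+1 * W)); rewrite ?leq_mul2r ?lt_t ?orbT // mulSn addnC ltn_add2r.
have -> : onth (certificate W C) i = Some (C t a k).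
  rewrite onthE (nth_map false) ?size_mkseq // nth_mkseq // divnMA iW.
  by rewrite divnMDl ?modnMDl ?(divn_small lt_a) ?(modn_small lt_a) ?addn0 ?modnMDl
    ?(modn_small lt_k) ?(leq_ltn_trans _ lt_k).
by rewrite /=; case: (C t a k).
Qed.

Lemma sum_support (T : finType) (w0 : T) (c : T -> nat) (P : pred T) n :
  let s := enum [set w | c w != 0] in size s <= n ->
  \sum_(a < n) P (nth w0 s a) * (if a < size s then c (nth w0 s a) else 0) =
  \sum_w c w * P w.
Proof.
move=> s le_n.
rewrite -(big_mkord xpredT (fun a => P (nth w0 s a) * (if a < size s then c (nth w0 s a) else 0))).
rewrite (big_cat_nat (leq0n _) le_n) /= [X in _ + X]big_nat [X in _ + X]big1 ?addn0; last first.
  by move=> a /andP[le_a _]; rewrite ltnNge le_a muln0.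
rewrite big_nat (eq_bigr (fun a => P (nth w0 s a) * c (nth w0 s a))) => [|a /andP[_ ->]//].
rewrite -big_nat -(big_nth w0 xpredT (fun w => P w * c w)) big_enum /= big_mkcond.
by apply: eq_bigr => w _; rewrite inE mulnC; case: (c w) => //=; rewrite mul0n.
Qed.

Lemma sparse_distribution (K : nat) (all_es : seq (itemset K * rat))
    (q : {ffun K.-tuple bool -> R}) (B : itemset K) (b : rat) :
  0 < size all_es -> distribution q ->
  (forall e, 0 < e < size all_es -> freq q (nth (set0, 0%R : rat) all_es e).1 =
     ratr (nth (set0, 0%R : rat) all_es e).2) ->
  (ratr b < freq q B)%R ->
  exists (D : nat) (c : K.-tuple bool -> nat),
  [/\ 0 < D <= (size all_es)`! * \prod_(e <- all_es) `|denq e.2|,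
      #|[set w | c w != 0]| <= size all_es, \sum_w c w = D,
      forall e, 0 < e < size all_es ->
        ((\sum_w c w * covers (nth (set0, 0%R : rat) all_es e).1 w)%:R =
        ratr (nth (set0, 0%R : rat) all_es e).2 * D%:R :> R)%R &
      (ratr b * D%:R < (\sum_w c w * covers B w)%N%:R :> R)%R].
Proof.
move=> es_gt0 [q_ge0 q_sum] q_eq lt_b; pose m := size all_es.
pose entry (e : nat) := nth (set0, 0%R : rat) all_es e.
(* Row 0 would belong to the target, which is no constraint; it is used for the total mass instead,
   with right-hand side 1. *)
pose a (r : 'I_m) : pred (K.-tuple bool) := fun w => (r == 0 :> nat) || covers (entry r).1 w.
pose rhs (r : 'I_m) := if r == 0 :> nat then 1%R else (entry r).2.
have q_feas : feasible a rhs q.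
  split=> // r; rewrite /a /rhs; case: eqP => [_|/eqP r_neq0] /=.
    by rewrite rmorph1 -q_sum; apply: eq_bigr => w _; rewrite mulr1n.
  by rewrite -freqE q_eq // lt0n r_neq0 ltn_ord.
rewrite freqE in lt_b.
have [//|D [c [D_le c_le c_eq c_b]]] := @sparse_solution R _ m a (Ordinal es_gt0) rhs (covers B) _ (ratr b) q q_feas lt_b.
exists D, c; split=> //.
(* The right-hand side of row 0 has denominator 1, at most the denominator of the threshold in that
   slot. *)
- case/andP: D_le => -> /leq_trans-> //; rewrite leq_mul2l; apply/orP; right.
  rewrite (big_nth (set0, 0%R : rat)) big_mkord; apply: leq_prod => r _; rewrite /rhs.
  by case: eqP => // _; rewrite absz_gt0 denq_eq0.
- have := c_eq (Ordinal es_gt0); rewrite /rhs /a /= rmorph1 mul1r => /eqP.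
  by rewrite eqr_nat => /eqP <-; apply: eq_bigr => w _; rewrite muln1.
move=> e /andP[e_gt0 lt_e]; have := c_eq (Ordinal lt_e).
by rewrite /rhs /a /= gtn_eqF.
Qed.

Lemma verify_complete x : MaxQueryDec R x ->
  exists2 u, size u <= 4 * ((size x).+1 * (size x).+1) * ((size x).+1 * (size x).+1) &
    verify (word_pair x u).
Proof.
case/MaxQueryDecP => K [B [b [es [xE K_gt0 es_uniq anti [q [dq sq bq]]]]]].
pose all_es := (B, b) :: es; have es_gt0 : 0 < size all_es by [].
pose entry (e : nat) := nth (set0, 0%R : rat) all_es e.
have sq' e : 0 < e < size all_es -> freq q (entry e).1 = ratr (entry e).2.
  by case: e => // e lt_e; apply: sq; apply: mem_nth.
have [D [c [/andP[D_gt0 D_le] c_supp c_sum c_eq c_b]]] := sparse_distribution es_gt0 dq sq' bq.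
pose n := size x; pose W := n.+1 * n.+1.
have sz_field m : m < size (entry_fields all_es) ->
    size (nth [::] (entry_fields all_es) m) < n.
  by move=> lt_m; rewrite /n xE size_join_nth.
have fieldE e : e < size all_es -> [/\ K < n, (`|numq (entry e).2| < 2 ^ n)%N &
    (`|denq (entry e).2| < 2 ^ n)%N].
  move=> lt_e; have lt_f : (3 * e).+2 < size (entry_fields all_es).
    by rewrite size_entry_fields; lia.
  have [f0 f1 f2] := nth_triples (fun e : itemset K * rat => member_field e.1)
    (fun e => num_field e.2) (fun e => den_field e.2) [::] (set0, 0%R : rat) lt_e.
  have := sz_field (3 * e) ltac:(lia); have := sz_field (3 * e).+1 ltac:(lia).
  have := sz_field (3 * e).+2 lt_f; rewrite /entry_fields f0 f1 f2 size_member_field /=.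
  move=> lt_d lt_n ->; split=> //.
    by apply: leq_trans (size_bits_nat _) _; rewrite leq_exp2l // ltnW // ltnW.
  by apply: leq_trans (size_bits_nat _) _; rewrite leq_exp2l // ltnW.
have size_le : size all_es <= n.
  by have := size_join_ge (entry_fields all_es); rewrite size_entry_fields -xE -/n; lia.
have D_lt : D < 2 ^ W.
  apply: (@leq_ltn_trans (2 ^ (n * n) * 2 ^ n)).
    apply: leq_trans D_le _; apply: leq_mul; last by rewrite /n xE prod_den_le.
    by apply: leq_trans (factorial_le _) _; rewrite leq_exp2l // leq_mul.
  by rewrite -expnD ltn_exp2l // /W; lia.
have c_lt w : c w < 2 ^ W.
  by apply: leq_ltn_trans D_lt; rewrite -c_sum (bigD1 w) //= leq_addr.
(* Indices beyond the entries get a dummy pair, so that one total function serves as a table. *)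
have /choice[bz hbz] : forall e, exists vw : nat * nat, e < size all_es ->
    [/\ vw.1 * `|denq (entry e).2| = vw.2 * `|numq (entry e).2| + 1,
        vw.1 < 2 ^ W & vw.2 < 2 ^ W].
  move=> e; case: (ltnP e (size all_es)) => [lt_e|_]; last by exists (0, 0).
  have [_ num_lt den_lt] := fieldE e lt_e.
  have den_gt0 : (0 < `|denq (entry e).2|)%N by rewrite absz_gt0 denq_eq0.
  have [v [w [vw [le_v lt_w]]]] := coprime_bezout den_gt0 (coprime_num_den _).
  exists (v, w) => _ /=; split=> //.
    apply: leq_ltn_trans le_v _; apply: (@leq_ltn_trans (2 ^ n * 2 ^ n)).
      by have p_gt0 : 0 < 2 ^ n; [rewrite expn_gt0 | nia].
    by rewrite -expnD ltn_exp2l // /W; lia.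
  by apply: leq_ltn_trans (ltnW lt_w) _; apply: leq_trans den_lt _; rewrite leq_exp2l // /W; lia.
(* Slots past the end of the support hold the zero vector with weight 0. *)
pose s := enum [set w | c w != 0]; pose w0 : K.-tuple bool := [tuple of nseq K false].
pose wt a := if a < size s then c (nth w0 s a) else 0.
pose C (t a k : nat) : bool := match t with
  | 0 => nth false (nth w0 s a) k
  | 1 => odd (wt a %/ 2 ^ k)
  | 2 => odd ((bz a).2 %/ 2 ^ k)
  | _ => odd ((bz a).1 %/ 2 ^ k) end.
pose u := certificate W C; exists u; first by rewrite size_mkseq mulnA.
pose z := word_pair x u.
have widthE : width z = W by rewrite /width input_size_word.
have size_leW : size all_es <= W by rewrite /W; lia.
have K_leW : K <= W by have [/ltnW] := fieldE 0 es_gt0; rewrite /W; lia.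
have s_le : size s <= W by rewrite -cardE (leq_trans c_supp).
have val_cert t a v : t < 4 -> a < W -> v < 2 ^ W ->
    (forall k, C t a k = odd (v %/ 2 ^ k)) ->
    value (fun k => cert z t a k) W = v.
  move=> lt_t lt_a lt_v hC; rewrite -[RHS](modn_small lt_v) -value_binary.
  by apply: eq_bigr => k _; rewrite cert_certificate // hC.
have weightE a : a < W -> weight x u a = wt a.
  move=> lt_a; rewrite /weight widthE; apply: val_cert => //.
  by rewrite /wt; case: ifP => // _; rewrite expn_gt0.
have vectE a : a < W -> vect K x u a = nth w0 s a.
  move=> lt_a; apply: eq_from_tnth => i; rewrite !(tnth_nth false) nth_mkseq //.
  by rewrite cert_certificate // (leq_trans (ltn_ord i)).
have sumE (P : pred (K.-tuple bool)) :
    \sum_(a < width z) P (vect K x u a) * weight x u a = \sum_w c w * P w.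
  rewrite widthE -(sum_support w0 P s_le); apply: eq_bigr => a _.
  by rewrite vectE ?weightE.
have totalE : total_weight x u = D.
  transitivity (\sum_w c w * xpredT w); last first.
    by rewrite -c_sum; apply: eq_bigr => w _; rewrite muln1.
  by rewrite -sumE; apply: eq_bigr => a _; rewrite mul1n.
have covE e : covered_weight all_es x u e = \sum_w c w * covers (entry e).1 w.
  exact: sumE.
have D_gt0R : (0 < D%:R :> R)%R by rewrite ltr0n.
rewrite /verify; apply/and5P; split.
- exact: check_layout_entries xE.
- apply/(all_entries u xE) => e lt_e.
  rewrite (check_entry_entries u K_gt0 es_gt0 xE lt_e) widthE.
  have [bzE v_lt w_lt] := hbz e lt_e.
  have lt_eW : e < W by apply: leq_trans size_leW.
  by rewrite (val_cert 3 e (bz e).1) // (val_cert 2 e (bz e).2) // bzE.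
- by rewrite (check_distinctE u K_gt0 es_gt0 xE).
- exact/(check_antimonotonicP u K_gt0 es_gt0 xE).
apply/andP; split.
  apply/(all_entries u xE) => e lt_e.
  rewrite (check_frequencyE u K_gt0 es_gt0 xE lt_e); apply/implyP => e_gt0.
  have e_in : 0 < e < size all_es by rewrite e_gt0.
  (* A listed frequency is a probability under [q]. *)
  have r_ge0 : (0 <= (entry e).2)%R.
    rewrite -(ler0q R) -(sq' e e_in) sumr_ge0 // => w _.
    by case: dq.
  rewrite r_ge0 covE totalE /= -(eqr_nat R) natrM c_eq // mulrAC ratr_num //.
  by rewrite -natrM mulnC.
rewrite (check_boundE u K_gt0 es_gt0 xE) totalE D_gt0 covE /=.
have [//|b_ge0] := ltP b 0%R.
have den_gt0 : (0 < (`|denq b|%N)%:R :> R)%R by rewrite ltr0n absz_gt0 denq_eq0.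
by rewrite -(ltr_nat R) !natrM -(ratr_num b_ge0) mulrA [(D%:R * _)%R]mulrC ltr_pM2r.
Qed.

End Correctness.

Unset Implicit Arguments.

Theorem theorem1 (R : realType) : in_NP (MaxQueryDec R).
Proof.
(* The certificate has 4 * W * W bits with W = (n+1)^2. *)
exists (fun w => verify w), (polyC 4%N * ('X + polyC 1%N) ^+ 4)%R.
split; first exact: verify_in_P.
move=> x; split=> [/verify_complete[u le_u ver]|[u [_ ver]]]; last exact: verify_sound ver.
exists u; split=> //; apply: leq_trans le_u _.
rewrite hornerM horner_exp hornerD hornerX !hornerC -[(size x + 1)%R]/(size x + 1) addn1.
by rewrite !GRing.exprS GRing.expr0 GRing.mulr1 -!mulnA.
Qed.
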